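(* Let $n\ge1$, $1<p<\infty$, let $V:\mathbb{R}^n\to[0,\infty)$ be a $p$-homogeneous convex function, and let $\nu$ be the measure on $\mathbb{R}^n$ with density $\frac{d\nu}{dx}=e^{-V}$. Let $t\in(0,1)$ and $\alpha\ge-\frac{p-1}{pn}$. If $h,f,g:\mathbb{R}^n\to[0,\infty)$ are measurable functions, with $f,g$ star-unimodal, satisfying $$h((1-t)x+ty)\ \ge\ \mathcal{M}^{(t)}_\alpha(f(x),g(y))\qquad\text{for all }x,y\in\mathbb{R}^n,$$ then $$\int h\,d\nu\ \ge\ \mathcal{M}^{(t)}_r\left(\int f\,d\nu,\ \int g\,d\nu\right),\qquad r=\frac{\alpha(p-1)}{\alpha pn+p-1}$$ (with $r=-\infty$ if $\alpha=-\frac{p-1}{pn}$).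
   Context: $V$ is $p$-homogeneous if $V(\lambda x)=\lambda^pV(x)$ for all $\lambda\ge0$, $x\in\mathbb{R}^n$. A set $K\subseteq\mathbb{R}^n$ is a star body if it is Borel and $\lambda K\subseteq K$ for all $\lambda\in[0,1]$. A function $f:\mathbb{R}^n\to\mathbb{R}$ is star-unimodal if $\{f\ge s\}$ is a star body for every $s\in\mathbb{R}$. For $a,b>0$ and $q\in\mathbb{R}\setminus\{0\}$, $\mathcal{M}^{(t)}_q(a,b)=\left((1-t)a^q+tb^q\right)^{1/q}$; $\mathcal{M}^{(t)}_0(a,b)=a^{1-t}b^t$; $\mathcal{M}^{(t)}_{-\infty}(a,b)=\min\{a,b\}$. Whenever $ab=0$ one sets $\mathcal{M}^{(t)}_q(a,b)=0$ for every $q$. If both arguments are positive and some argument is $+\infty$, the mean is understood as the corresponding monotone limit. *)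

(* Defs.v *)
From HB Require Import structures.
From mathcomp Require Import all_boot all_order all_algebra.
From mathcomp Require Import all_classical all_reals all_analysis.
Import Order.TTheory GRing.Theory Num.Theory.
Import numFieldNormedType.Exports.

Set Implicit Arguments.
Unset Strict Implicit.
Unset Printing Implicit Defensive.

Local Open Scope classical_set_scope.
Local Open Scope ring_scope.

(* The measurable sets of 'rV[R]_n are the Borel sets of its topology. *)
HB.instance Definition _ (R : realType) (n : nat) :=
  Measurable.copy 'rV[R]_n (g_sigma_algebraType (@open 'rV[R]_n)).

Section lebesgue_rV.
Context {R : realType}.

Lemma open_measurable_rV n (U : set 'rV[R]_n) : open U -> measurable U.
Proof. by move=> oU; exact: sub_sigma_algebra. Qed.

Definition cons_rV n (p : measurableTypeR R * 'rV[R]_n) : 'rV[R]_n.+1 :=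
  row_mx (p.1 : R)%:M p.2 : 'rV[R]_(1 + n).

Definition head_rV n (v : 'rV[R]_n.+1) : R := v ord0 ord0.

Definition tail_rV n (v : 'rV[R]_n.+1) : 'rV[R]_n :=
  rsubmx (v : 'rV[R]_(1 + n)).

Lemma cons_rV0 n p : @cons_rV n p ord0 ord0 = p.1.
Proof.
rewrite (_ : ord0 = lshift n (ord0 : 'I_1) :> 'I_n.+1); last exact: val_inj.
by apply: etrans (row_mxEl _ _ _ _) _; rewrite mxE eqxx.
Qed.

Lemma cons_rVS n p i : @cons_rV n p ord0 (lift ord0 i) = p.2 ord0 i.
Proof.
rewrite (_ : lift ord0 i = rshift 1 i); last exact: val_inj.
exact: row_mxEr.
Qed.

Lemma tail_rVE n v i : @tail_rV n v ord0 i = v ord0 (lift ord0 i).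
Proof. by rewrite mxE; congr (v _ _); exact: val_inj. Qed.

Lemma open_bigcup_ball_rat n (U : set 'rV[R]_n) : open U ->
  exists P : set ('rV[rat]_n * nat),
    U = \bigcup_(qk in P) ball (map_mx ratr qk.1 : 'rV[R]_n) qk.2.+1%:R^-1.
Proof.
move=> oU.
exists [set qk | ball (map_mx ratr qk.1 : 'rV[R]_n) qk.2.+1%:R^-1 `<=` U].
apply/seteqP; split=> [x Ux|x [qk]]; last exact.
have [e /= e0 xeU] : nbhs_ball x U.
  by apply/nbhs_ballP; move: oU; rewrite openE => /(_ _ Ux).
have e2 : 0 < e / 2 by rewrite divr_gt0.
have [k _ /(_ k (leqnn _)) ke] := near_infty_natSinv_lt (PosNum e2).
have kgt0 : 0 < k.+1%:R^-1 :> R by rewrite invr_gt0.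
have H i : exists q : rat, `|ratr q - x ord0 i| < k.+1%:R^-1 :> R.
  have [|q] := @rat_in_itvoo R (x ord0 i - k.+1%:R^-1) (x ord0 i + k.+1%:R^-1).
    by rewrite ltrBlDr -addrA ltrDl addr_gt0.
  by rewrite in_itv/= -ltr_distl => ?; exists q.
pose q : 'rV[rat]_n := \row_i sval (cid (H i)).
have Hq i : `|ratr (q ord0 i) - x ord0 i| < k.+1%:R^-1 :> R.
  by rewrite mxE; exact: (svalP (cid (H i))).
have qx : ball (map_mx ratr q : 'rV[R]_n) k.+1%:R^-1 x.
  by split=> // i j; rewrite !ord1 mxE; exact: Hq.
exists (q, k) => //= y qy; apply: xeU.
have xq : ball x (e / 2) (map_mx ratr q : 'rV[R]_n).
  by apply: ball_sym; apply: le_ball qx; exact: ltW.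
have {}qy : ball (map_mx ratr q : 'rV[R]_n) (e / 2) y.
  by apply: le_ball qy; exact: ltW.
by have := ball_triangle xq qy; rewrite -splitr.
Qed.

Lemma measurable_cons_rV n : measurable_fun setT (@cons_rV n).
Proof.
apply: (measurability (@open 'rV[R]_n.+1)) => // _ [U oU <-]; rewrite setTI.
have [P ->] := open_bigcup_ball_rat oU.
rewrite preimage_bigcup bigcup_mkcond.
apply: countable_bigcupT_measurable => // -[q k].
case: ifP => // _; rewrite /=.
rewrite [X in measurable X](_ : _ =
  (ball (ratr (q ord0 ord0) : R) (k.+1%:R^-1)) `*`
  (ball (tail_rV (map_mx ratr q : 'rV[R]_n.+1)) (k.+1%:R^-1))).
  apply: measurableX.
    by rewrite ball_itv; exact: measurable_itv.
  apply: open_measurable_rV; apply: ball_open.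
apply/seteqP; split=> [[a v] /= [k0 h]|[a v] /= [h0 [k0 h]]].
  split; first by have := h ord0 ord0; rewrite cons_rV0 mxE.
  split=> // i j; have := h ord0 (lift ord0 j).
  by rewrite cons_rVS (ord1 i) tail_rVE !mxE.
split=> // i j; rewrite ord1; case: (unliftP ord0 j) => [l|] ->.
  by have := h ord0 l; rewrite cons_rVS tail_rVE.
by rewrite cons_rV0 mxE.
Qed.


Lemma measurable_head_rV n :
  measurable_fun setT (@head_rV n : 'rV[R]_n.+1 -> measurableTypeR R).
Proof.
apply: (measurability (@measurable_realfun.RGenOpens.G R)); first exact: measurable_realfun.RGenOpens.measurableE.
move=> _ [_ [a [b ->]] <-]; rewrite setTI; apply: open_measurable_rV.
have oU : open `]a, b[%classic by exact: interval_open.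
by apply: open_comp => // x _; exact: coord_continuous.
Qed.

Lemma measurable_tail_rV n : measurable_fun setT (@tail_rV n).
Proof.
apply: (measurability (@open 'rV[R]_n)) => // _ [U oU <-].
rewrite setTI; apply: open_measurable_rV.
by apply: open_comp => // x _; exact: (@continuous_rsubmx R 1 1 n).
Qed.

Lemma cons_rVK n : cancel (@cons_rV n) (fun v => (head_rV v, tail_rV v)).
Proof.
case=> a v; congr (_, _); first exact: cons_rV0.
by apply/rowP => i; rewrite tail_rVE cons_rVS.
Qed.

Definition lebesgue_rV_step n (m : {sigma_finite_measure set 'rV[R]_n -> \bar R})
  : set 'rV[R]_n.+1 -> \bar R :=
  pushforward (lebesgue_measure \x m)%E (@cons_rV n).

Section step.
Variables (n : nat) (m : {sigma_finite_measure set 'rV[R]_n -> \bar R}).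
Let mcons := @measurable_cons_rV n.

Let step0 : lebesgue_rV_step m set0 = 0%E.
Proof. by rewrite /lebesgue_rV_step /pushforward preimage_set0 measure0. Qed.

Let step_ge0 A : (0 <= lebesgue_rV_step m A)%E.
Proof. exact: measure_ge0. Qed.

Let step_sigma_additive : semi_sigma_additive (lebesgue_rV_step m).
Proof.
exact: (@measure_semi_sigma_additive _ _ _
  (measure_function_pushforward__canonical__measure_function_Measure
    (lebesgue_measure \x m)%E mcons)).
Qed.

HB.instance Definition _ := isMeasure.Build _ _ _ (lebesgue_rV_step m)
  step0 step_ge0 step_sigma_additive.

Let step_sigma_finite : sigma_finite setT (lebesgue_rV_step m).
Proof.
have muncons : measurable_fun setT
    (fun v : 'rV[R]_n.+1 => (head_rV v : measurableTypeR R, tail_rV v)).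
  apply/measurable_fun_pairP; split; first exact: measurable_head_rV.
  exact: measurable_tail_rV.
have /sigma_finiteP[F [TF ndF Foo]] :=
  sigma_finiteT (@lebesgue_measure R : {sigma_finite_measure set _ -> \bar R}).
have /sigma_finiteP[G [TG ndG Goo]] := sigma_finiteT m.
pose u (v : 'rV[R]_n.+1) := (head_rV v : measurableTypeR R, tail_rV v).
exists (fun k => u @^-1` (F k `*` G k)).
  rewrite -preimage_bigcup (_ : \bigcup_k _ = setT) ?preimage_setT//.
  rewrite -subTset => -[x y] _.
  have [i _ Fx] : (\bigcup_i F i) x by rewrite -TF.
  have [j _ Gy] : (\bigcup_i G i) y by rewrite -TG.
  exists (maxn i j) => //; split => /=.
    by move: x Fx; exact/subsetPset/ndF/leq_maxl.
  by move: y Gy; exact/subsetPset/ndG/leq_maxr.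
move=> k; have [mF Fk] := Foo k; have [mG Gk] := Goo k; split.
  by rewrite -[X in measurable X]setTI; apply: muncons => //; exact: measurableX.
rewrite /lebesgue_rV_step /pushforward -comp_preimage.
rewrite (_ : _ \o _ = id); last by apply/funext => p; exact: cons_rVK.
rewrite preimage_id product_measure1E// lte_mul_pinfty//.
by rewrite ge0_fin_numE.
Qed.

HB.instance Definition _ := Measure_isSigmaFinite.Build _ _ _
  (lebesgue_rV_step m) step_sigma_finite.

End step.

(* Identifying 'rV[R]_n.+1 with R x 'rV[R]_n, Lebesgue measure is the product
   of one-dimensional Lebesgue measures. *)
Fixpoint lebesgue_rV n : {sigma_finite_measure set 'rV[R]_n -> \bar R} :=
  match n with
  | 0 => \d_(0 : 'rV[R]_0)
  | n'.+1 => lebesgue_rV_step (lebesgue_rV n')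
  end.

Lemma lebesgue_rV_box n (a b : 'rV[R]_n) : (forall i, a ord0 i <= b ord0 i) ->
  lebesgue_rV n
    [set x : 'rV[R]_n | forall i, a ord0 i <= x ord0 i <= b ord0 i] =
  (\prod_i (b ord0 i - a ord0 i))%:E.
Proof.
have mbox k (c d : 'rV[R]_k) :
    measurable [set x : 'rV[R]_k | forall i, c ord0 i <= x ord0 i <= d ord0 i].
  rewrite [X in measurable X](_ : _ = \bigcap_(i in [set: 'I_k])
      (fun x : 'rV[R]_k => x ord0 i) @^-1` `[c ord0 i, d ord0 i]).
    rewrite -[X in measurable X]setCK; apply: measurableC.
    apply: open_measurable_rV; rewrite openC; apply: closed_bigI => i _.
    apply: closed_comp; last exact: itv_closed.
    by move=> x _; exact: coord_continuous.
  apply/seteqP; split => x /= cxd i; first by move=> _; rewrite /= in_itv/= cxd.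
  by have := cxd i I; rewrite /= in_itv.
elim: n a b => [|n IH] a b ab.
  rewrite big_ord0 (_ : [set x | _] = setT); first exact: diracT.
  by apply/seteqP; split=> // x _ [].
rewrite big_ord_recl EFinM.
rewrite [LHS](_ : _ = (lebesgue_measure \x lebesgue_rV n)%E
  (`[a ord0 ord0, b ord0 ord0] `*`
   [set x : 'rV[R]_n | forall i,
     tail_rV a ord0 i <= x ord0 i <= tail_rV b ord0 i])).
  have E := product_measure1E (@lebesgue_measure R) (lebesgue_rV n)
    (measurable_itv `[a ord0 ord0, b ord0 ord0])
    (mbox n (tail_rV a) (tail_rV b)).
  apply: (etrans E).
  rewrite IH; last by move=> i; rewrite !tail_rVE.
  rewrite [X in (X * _)%E]lebesgue_measure_itv/= lte_fin -EFinB.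
  have -> : (if a ord0 ord0 < b ord0 ord0 then
      (b ord0 ord0 - a ord0 ord0)%:E else 0%E) =
      (b ord0 ord0 - a ord0 ord0)%:E.
    case: ltgtP (ab ord0) => // -> _; by rewrite subrr.
  by congr (_ * _%:E)%E; apply: eq_bigr => i _; rewrite !tail_rVE.
rewrite /= /lebesgue_rV_step /pushforward; congr (product_measure1 _ _ _).
apply/seteqP; split=> [[x v] /= h|[x v] /= [h0 h] i].
  split; first by have := h ord0; rewrite cons_rV0 /= in_itv.
  by move=> i; have := h (lift ord0 i); rewrite cons_rVS !tail_rVE.
case: (unliftP ord0 i) => [l|] ->.
  by have := h l; rewrite cons_rVS !tail_rVE.
by rewrite cons_rV0; move: h0; rewrite in_itv.
Qed.

End lebesgue_rV.

Section star.
Context {R : realType} {n : nat}.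

Definition p_homogeneous (p : R) (V : 'rV[R]_n -> R) :=
  forall (l : R) (x : 'rV[R]_n), 0 <= l -> V (l *: x) = l `^ p * V x.

Definition star_body (K : set 'rV[R]_n) :=
  measurable K /\
  forall l : R, 0 <= l <= 1 -> [set l *: x | x in K] `<=` K.

Definition star_unimodal (f : 'rV[R]_n -> R) :=
  forall s : R, star_body [set x | s <= f x].

End star.

Section means.
Context {R : realType}.

(* The mean of order q with weights 1 - t and t, for real a, b >= 0. The orders
   of interest are -oo and the reals; +oo gets its usual value, the maximum. *)
Definition power_mean (t : R) (q : \bar R) (a b : R) : R :=
  if a * b == 0 then 0 else
  match q with
  | r%:E => if r == 0 then a `^ (1 - t) * b `^ t
            else ((1 - t) * a `^ r + t * b `^ r) `^ r^-1
  | -oo%E => Num.min a b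
  | +oo%E => Num.max a b
  end.

(* Extension to a, b in [0, +oo]. As the mean is nondecreasing in each argument,
   its limit when finite x, y increase to a, b is the supremum below; when a or
   b is 0 that supremum is 0. *)
Definition epower_mean (t : R) (q : \bar R) (a b : \bar R) : \bar R :=
  match a, b with
  | x%:E, y%:E => (power_mean t q x y)%:E
  | _, _ => ereal_sup [set (power_mean t q xy.1 xy.2)%:E | xy in
      [set xy : R * R | (0 <= xy.1) && (xy.1%:E <= a)%E &&
                        (0 <= xy.2) && (xy.2%:E <= b)%E]]
  end.

End means.

(* Main.v *)
Require Import Defs.
From HB Require Import structures.
From mathcomp Require Import all_boot all_order all_algebra.
From mathcomp Require Import all_classical all_reals all_analysis.
From mathcomp Require Import measurable_realfun measurable_fun_approximation.
From mathcomp Require Import ring lra.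
Import Order.TTheory GRing.Theory Num.Theory.
Import numFieldNormedType.Exports.

(** Let N = p n / (p - 1), so that the hypothesis on alpha reads
    alpha >= - 1 / N and that r = alpha / (1 + N alpha), or formally
    1 / r = 1 / alpha + N. The measure nu behaves on star bodies like Lebesgue
    measure in dimension N.

    Sets. For star bodies K and L of positive measure,
      nu ((1 - t) K + t L)^(1/N) >= (1 - t) nu(K)^(1/N) + t nu(L)^(1/N)
    (star_brunn_minkowski). By symmetry, let K be the one of larger measure.
    Apply the Prekopa-Leindler inequality with a weight
    s, in general different from t, to dilates of exp(- V) 1_K and of
    exp(- c V) 1_L. Convexity and homogeneity give
      V ((1 - t) x + t y) <= (1 - s) V x + s c V y
    for an explicit c (potential_tangent). Replacing V by c V on a star body
    costs at most a factor c^(- n / p), because the dilate of L by c^(- 1 / p)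
    is contained in L if c >= 1 (integral_damped_star). The
    dilations bring in a factor exp (- n D), where D is the relative entropy of
    (1 - s, s) with respect to (1 - t, t). What is needed is
      s ln c <= p / (p - 1) D
    (amp_entropy); it follows from the concavity of exp(- (p - 1) / p y^p)
    on [0, 1] (concave_expRN_powR). The choice of s that makes the dilated sets
    balanced then gives the claim.

    Functions. By the hypothesis on h, the superlevel set of h at the level
    M_alpha(u, v) contains the Minkowski combination of those of f at u and of g
    at v, which are star bodies. Rearranging f, g and h decreasingly on the
    half-line with the measure d(A^N) turns the inequality between sets into a
    hypothesis of Borell-Brascamp-Lieb type in dimension one, of order
    gamma = alpha / (1 + (N - 1) alpha), and alpha >= - 1 / N amounts to
    gamma >= - 1 (borell_brascamp_lieb_superlevel). The one-dimensional
    inequality (borell_brascamp_lieb_line) yields the order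
    gamma / (1 + gamma) = r.

    Both the one-dimensional inequality and, by induction on the dimension, the
    Prekopa-Leindler inequality rest on Brunn-Minkowski on the line
    (brunn_minkowski_line).

    Infinite integrals are covered by stating every functional inequality for
    all pairs of real numbers below the functions and below their
    integrals. *)

Set Implicit Arguments.
Unset Strict Implicit.
Unset Printing Implicit Defensive.

Local Open Scope classical_set_scope.
Local Open Scope ring_scope.

(** * Power means *)

Section means.
Context {R : realType}.
Implicit Types (t a b x y z u v w c theta : R).

Lemma wmean_gt0 t x y : 0 < t < 1 -> 0 < x -> 0 < y -> 0 < (1 - t) * x + t * y.
Proof.
by move=> /andP[t0 t1] x0 y0; rewrite addr_gt0// mulr_gt0// subr_gt0.
Qed.

Lemma ln_wmean_ge t x y : 0 <= t <= 1 -> 0 < x -> 0 < y ->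
  (1 - t) * ln x + t * ln y <= ln ((1 - t) * x + t * y).
Proof.
move=> /andP[t0 t1] x0 y0.
have := @concave_ln R (Itv01 t0 t1) y x y0 x0.
rewrite !convRE/= => h.
by rewrite addrC [X in _ <= ln X]addrC.
Qed.

Lemma powR_wmean_ge t x y : 0 <= t <= 1 -> 0 < x -> 0 < y ->
  x `^ (1 - t) * y `^ t <= (1 - t) * x + t * y.
Proof.
move=> t01 x0 y0; have := ln_wmean_ge t01 x0 y0.
have z0 : 0 < (1 - t) * x + t * y.
  move: t01 => /andP[+ t1]; rewrite le_eqVlt => /predU1P[<-|t0].
    by rewrite subr0 mul1r mul0r addr0.
  by rewrite ltr_wpDl ?mulr_gt0// mulr_ge0 ?subr_ge0// ltW.
move=> h; rewrite -ler_expR in h; apply: le_trans (le_trans h _); last by rewrite lnK.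
by rewrite expRD /powR !gt_eqF.
Qed.

(** Dividing by the right-hand side makes both weighted sums equal to 1, and
    the weighted AM-GM inequality, applied to each summand, then gives 1. *)
Lemma hoelder_wmean t theta x x' y y' : 0 < t < 1 -> 0 <= theta <= 1 ->
  0 < x -> 0 < x' -> 0 < y -> 0 < y' ->
  (1 - t) * (x `^ theta * x' `^ (1 - theta)) +
    t * (y `^ theta * y' `^ (1 - theta)) <=
  ((1 - t) * x + t * y) `^ theta * ((1 - t) * x' + t * y') `^ (1 - theta).
Proof.
move=> t01 th01 x0 x'0 y0 y'0.
have S0 := wmean_gt0 t01 x0 y0; have S'0 := wmean_gt0 t01 x'0 y'0.
set S := _ + _ in S0 *; set S' := (1 - t) * x' + t * y' in S'0 *.
have P0 : 0 < S `^ theta * S' `^ (1 - theta) by rewrite mulr_gt0// powR_gt0.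
have key z z' : 0 < z -> 0 < z' -> z `^ theta * z' `^ (1 - theta) <=
    (theta * (z / S) + (1 - theta) * (z' / S')) *
    (S `^ theta * S' `^ (1 - theta)).
  move=> z0 z'0.
  have th01' : 0 <= 1 - theta <= 1 by move: th01; lra.
  have := powR_wmean_ge th01' (divr_gt0 z0 S0) (divr_gt0 z'0 S'0).
  rewrite (_ : 1 - (1 - theta) = theta); last by ring.
  move=> /(ler_wpM2r (ltW P0)); apply: le_trans.
  rewrite mulrACA -!powRM ?divr_ge0 ?(ltW z0) ?(ltW z'0) ?(ltW S0) ?(ltW S'0)//.
  by rewrite !divfK ?gt_eqF.
move: t01 => /andP[t0 t1].
have t1' : 0 <= 1 - t by rewrite subr_ge0 ltW.
apply: le_trans (lerD (ler_wpM2l t1' (key x x' x0 x'0))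
  (ler_wpM2l (ltW t0) (key y y' y0 y'0))) _.
rewrite -/S -/S'; set K := S `^ _ * _.
rewrite [X in X + _]mulrA [X in _ + X]mulrA -mulrDl -[leRHS]mul1r.
rewrite le_eqVlt; apply/orP; left; apply/eqP; congr (_ * _).
have -> : (1 - t) * (theta * (x / S) + (1 - theta) * (x' / S')) +
    t * (theta * (y / S) + (1 - theta) * (y' / S')) =
    theta * (((1 - t) * x + t * y) / S) +
    (1 - theta) * (((1 - t) * x' + t * y') / S') by ring.
rewrite -/S -/S'.
by rewrite !divff ?gt_eqF//; ring.
Qed.

Lemma gt0_powRD x (r s : R) : 0 < x -> x `^ (r + s) = x `^ r * x `^ s.
Proof. by move=> x0; rewrite powRD// (gt_eqF x0) implybT. Qed.

Lemma power_mean_gt0 t (q : \bar R) u v : 0 < t < 1 -> (q < +oo)%E ->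
  0 < u -> 0 < v -> 0 < power_mean t q u v.
Proof.
move=> t01 qoo u0 v0; rewrite /power_mean mulf_eq0 !gt_eqF//=.
case: q qoo => [r _| |_]//; last by rewrite lt_min u0.
case: ifP => _; first by rewrite mulr_gt0// powR_gt0.
by rewrite powR_gt0// wmean_gt0// powR_gt0.
Qed.

Lemma power_meanZ t (q : \bar R) c u v : 0 < t < 1 -> 0 < c ->
  0 < u -> 0 < v -> power_mean t q (c * u) (c * v) = c * power_mean t q u v.
Proof.
move=> t01 c0 u0 v0; rewrite /power_mean !mulf_eq0 !gt_eqF//=.
case: q => [r| |]; last 2 first.
- by rewrite maxr_pMr// ltW.
- by rewrite minr_pMr// ltW.
have [_|r0] := eqVneq r 0.
  rewrite !powRM ?ltW// mulrACA -gt0_powRD//.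
  by rewrite subrK powRr1// ltW.
rewrite !powRM ?ltW// mulrCA (mulrCA t) -mulrDr.
rewrite powRM ?powR_ge0//; last by rewrite ltW// wmean_gt0// powR_gt0.
by rewrite -powRrM divff// powRr1// ltW.
Qed.

(** Orders of means add harmonically under products: the left mean has order c
    with 1/c = 1/al + be, and the last factor is a mean of order 1/be of
    x'^be and y'^be. The inequality is Hoelder's for al > 0 and the
    reverse Hoelder inequality for al < 0; the condition al >= -1/be says that
    the orders al and 1/be have a nonnegative sum, and in the limiting case
    the product order is -oo. *)
Lemma power_mean_hoelder t (al be : R) x x' y y' : 0 < t < 1 -> 0 < be ->
  - be^-1 <= al -> 0 < x -> 0 < x' -> 0 < y -> 0 < y' ->
  power_mean t (if al == - be^-1 then -oo%E else (al / (1 + be * al))%:E)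
    (x * x' `^ be) (y * y' `^ be) <=
  power_mean t al%:E x y * ((1 - t) * x' + t * y') `^ be.
Proof.
move=> t01 be0 albe x0 x'0 y0 y'0.
have S'0 := wmean_gt0 t01 x'0 y'0; set S' := _ + _ in S'0 *.
have xx0 : 0 < x * x' `^ be by rewrite mulr_gt0// powR_gt0.
have yy0 : 0 < y * y' `^ be by rewrite mulr_gt0// powR_gt0.
rewrite /power_mean !(mulf_eq0 _ _) !(gt_eqF x0) !(gt_eqF y0)/=.
rewrite !powR_eq0 !(gt_eqF x'0) !(gt_eqF y'0)/=.
have nz : al != 0 -> 0 < (1 - t) * x `^ al + t * y `^ al.
  by move=> _; rewrite wmean_gt0// powR_gt0.
case: ifPn => [/eqP alE|albe'].
  have al0 : al != 0 by rewrite alE oppr_eq0 invr_eq0 gt_eqF.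
  rewrite (negbTE al0); set m := Num.min _ _.
  have m0 : 0 < m by rewrite /m lt_min xx0 yy0.
  have S0 := nz al0; set S := _ + _ in S0 *.
  have alV : al^-1 = - be by rewrite alE invrN invrK.
  have key z z' : 0 < z -> 0 < z' -> m <= z * z' `^ be ->
      m `^ be^-1 * z `^ al <= z'.
    move=> z0 z'0 mz.
    rewrite alE powRN ler_pdivrMr ?powR_gt0//.
    have bei : 0 <= be^-1 by rewrite invr_ge0 ltW.
    have := ge0_ler_powR bei _ _ mz; rewrite !nnegrE => /(_ (ltW m0)) h.
    have {h} := h (mulr_ge0 (ltW z0) (powR_ge0 _ _)).
    rewrite powRM ?powR_ge0 ?(ltW z0)// -powRrM divff ?gt_eqF// powRr1 ?(ltW z'0)//.
    by rewrite mulrC.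
  have hx := key _ _ x0 x'0 (ltac:(by rewrite /m ge_min lexx)).
  have hy := key _ _ y0 y'0 (ltac:(by rewrite /m ge_min lexx orbT)).
  have h : m `^ be^-1 * S <= S'.
    move/andP: t01 => [t0 t1]; rewrite /S /S' mulrDr mulrCA [X in _ + X]mulrCA.
    apply: lerD; apply: ler_wpM2l => //; last exact: ltW.
    by rewrite subr_ge0 ltW.
  rewrite alV powRN ler_pdivlMl ?powR_gt0//.
  have mS0 : 0 <= m `^ be^-1 * S by rewrite mulr_ge0 ?powR_ge0// ltW.
  have := ge0_ler_powR (ltW be0) _ _ h; rewrite !nnegrE => /(_ mS0 (ltW S'0)).
  rewrite powRM ?powR_ge0 ?(ltW S0)// -powRrM mulVf ?gt_eqF// powRr1 ?(ltW m0)//.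
  by rewrite mulrC.
have den0 : 0 < 1 + be * al.
  rewrite -(mulVf (lt0r_neq0 be0)) mulrC -mulrDr mulr_gt0//.
  by rewrite addrC -[X in _ + X]opprK subr_gt0 lt_neqAle eq_sym albe' albe.
rewrite mulf_eq0 invr_eq0 (gt_eqF den0) orbF.
have [_|al0] := eqVneq al 0.
  rewrite !powRM ?powR_ge0 ?(ltW x0) ?(ltW y0)// mulrACA ler_pM2l ?mulr_gt0 ?powR_gt0//.
  rewrite -!powRrM ![be * _]mulrC !powRrM -powRM ?powR_ge0//.
  apply: ge0_ler_powR; rewrite ?nnegrE ?mulr_ge0 ?powR_ge0 ?(ltW be0) ?(ltW S'0)//.
  apply: powR_wmean_ge => //; by move: t01; lra.
have S0 := nz al0; set S := _ + _ in S0 *.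
set ga := al / _.
have ga0 : ga != 0 by rewrite mulf_neq0// invr_eq0 gt_eqF.
have gaV : ga^-1 = al^-1 + be by rewrite /ga invf_div mulrDl mul1r mulfK.
set T := (1 - t) * _ + t * _.
have T0 : 0 < T by rewrite wmean_gt0// powR_gt0.
(* the two factors as powers of a common exponent *)
pose th := ga / al.
have thE : th = (1 + be * al)^-1 by rewrite /th /ga mulrAC divff// mul1r.
have th0 : 0 < th by rewrite thE invr_gt0.
have th1 : 1 - th = be * ga.
  rewrite thE /ga.
  apply: (mulIf (lt0r_neq0 den0)); rewrite mulrBl mulVf ?gt_eqF//.
  by rewrite mulrA divfK ?gt_eqF//; ring.
have TE z z' : 0 < z -> 0 < z' -> (z * z' `^ be) `^ ga =
    (z `^ al) `^ th * z' `^ (1 - th).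
  move=> z0 z'0; rewrite powRM ?powR_ge0 ?(ltW z0)// -!powRrM th1.
  by congr (_ `^ _ * _); rewrite /th mulrCA divff// mulr1.
rewrite -[leRHS](@powRr1 _ _) ?mulr_ge0 ?powR_ge0//.
rewrite -(mulfV ga0) powRrM.
have RE : (S `^ al^-1 * S' `^ be) `^ ga = S `^ th * S' `^ (1 - th).
  rewrite powRM ?powR_ge0// -!powRrM th1; congr (_ `^ _ * _).
  by rewrite mulrC.
rewrite RE.
have [alp|aln] := ltP 0 al.
  have gap : 0 < ga by rewrite divr_gt0.
  apply: ge0_ler_powR; rewrite ?nnegrE ?mulr_ge0 ?powR_ge0 ?invr_ge0 ?(ltW gap) ?(ltW T0)//.
  rewrite /T !TE//; apply: hoelder_wmean; rewrite ?powR_gt0//.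
  rewrite (ltW th0)/= thE invf_le1// lerDl mulr_ge0 ?ltW//.
have {}aln : al < 0 by rewrite lt_neqAle al0.
have gan : ga < 0 by rewrite pmulr_llt0// invr_gt0.
have thV : 0 <= th^-1 <= 1.
  by rewrite invr_ge0 (ltW th0) thE invrK gerDl mulr_ge0_le0 ?ltW.
rewrite -[ga^-1]opprK !(powRN _ (- _)) lef_pV2 ?posrE ?powR_gt0 ?mulr_gt0 ?powR_gt0//.
apply: ge0_ler_powR; rewrite ?nnegrE ?mulr_ge0 ?powR_ge0 ?oppr_ge0 ?invr_le0 ?(ltW gan) ?(ltW T0)//.
have V z z' : 0 < z -> 0 < z' ->
    z `^ al = ((z * z' `^ be) `^ ga) `^ th^-1 * z' `^ (1 - th^-1).
  move=> z0 z'0; rewrite TE// powRM ?powR_ge0// -!powRrM.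
  rewrite mulfV ?gt_eqF// mulr1 -mulrA -gt0_powRD//.
  rewrite mulrBl mul1r mulfV ?gt_eqF//.
  by rewrite addrA subrK subrr powRr0 mulr1.
(* For al < 0 the exponent th is at least 1. Solving TE for z^al writes S as a
   sum to which Hoelder's inequality with exponent 1/th applies. *)
have hV : S <= T `^ th^-1 * S' `^ (1 - th^-1).
  rewrite /S (V x x')// (V y y')//; apply: hoelder_wmean => //; exact: powR_gt0.
have := ge0_ler_powR (ltW th0) _ _ hV; rewrite !nnegrE => /(_ (ltW S0)) h.
have {h} := h (mulr_ge0 (powR_ge0 _ _) (powR_ge0 _ _)).
rewrite powRM ?powR_ge0// -!powRrM mulVf ?gt_eqF// powRr1 ?(ltW T0)//.
rewrite mulrBl mul1r mulVf ?gt_eqF//.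
move=> /(ler_wpM2r (powR_ge0 S' (1 - th))); rewrite -mulrA -gt0_powRD//.
by rewrite addrA subrK subrr powRr0 mulr1.
Qed.

Lemma power_mean_le (t q u v x y : R) : 0 < t < 1 -> 0 < u -> 0 < v ->
  u <= x -> v <= y -> power_mean t q%:E u v <= power_mean t q%:E x y.
Proof.
move=> t01 u0 v0 ux vy; have [t0 t1] := andP t01.
have t1' : 0 < 1 - t by rewrite subr_gt0.
have x0 := lt_le_trans u0 ux; have y0 := lt_le_trans v0 vy.
have incr (r a b : R) : 0 <= r -> 0 < a -> a <= b -> a `^ r <= b `^ r.
  move=> r0 a0 ab; apply: ge0_ler_powR; rewrite ?nnegrE ?(ltW a0)//.
  exact/ltW/(lt_le_trans a0).
have decr (r a b : R) : r <= 0 -> 0 < a -> a <= b -> b `^ r <= a `^ r.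
  move=> r0 a0 ab; rewrite -[r]opprK !(powRN _ (- r)).
  rewrite lef_pV2 ?posrE ?powR_gt0 ?(lt_le_trans a0 ab)//.
  by apply: incr; rewrite ?oppr_ge0.
rewrite /power_mean !mulf_eq0 (gt_eqF u0) (gt_eqF v0) (gt_eqF x0) (gt_eqF y0)/=.
have [_|q0] := eqVneq q 0.
  apply: ler_pM; rewrite ?powR_ge0//; apply: incr => //; exact: ltW.
have S0 : 0 < (1 - t) * u `^ q + t * v `^ q by rewrite wmean_gt0 ?powR_gt0.
have S1 : 0 < (1 - t) * x `^ q + t * y `^ q by rewrite wmean_gt0 ?powR_gt0.
have [qp|qn] := leP 0 q.
  apply: (incr) => //; first by rewrite invr_ge0.
  by apply: lerD; (apply: ler_wpM2l; [exact: ltW|exact: incr]).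
apply: (decr) => //; first by rewrite invr_le0 ltW.
by apply: lerD; (apply: ler_wpM2l; [exact: ltW|apply: decr => //; exact: ltW]).
Qed.

End means.

(** * Superlevel sets, and the Brunn-Minkowski inequality on the line *)

Section superlevel.
Context d (T : measurableType d) (R : realType).
Implicit Types F : T -> \bar R.

(** Levels u <= 0 get the empty set, so that the layer cake formula needs no
    restriction on the range of integration. *)
Definition superlevel F (u : R) := [set x | 0 < u /\ (u%:E <= F x)%E].

Lemma measurable_superlevel2 F : measurable_fun setT F ->
  measurable [set z : T * measurableTypeR R | superlevel F z.2 z.1].
Proof.
move=> mF; pose S2 := (T * measurableTypeR R)%type.
rewrite (_ : [set _ | _] =
  (snd @^-1` `]0%R, +oo[%classic) `&` [set z : S2 | (z.2%:E <= F z.1)%E]); last first.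
  by apply/seteqP; split=> -[x u] /=; rewrite in_itv/= andbT.
apply: measurableI.
  rewrite -[X in measurable X]setTI; exact: measurable_snd.
rewrite -[X in measurable X]setTI; apply: measurable_lee => //.
  by apply/measurable_EFinP; exact: measurable_snd.
by apply: measurableT_comp => //; exact: measurable_fst.
Qed.

Lemma measurable_superlevel F u : measurable_fun setT F ->
  measurable (superlevel F u).
Proof.
move=> /measurable_superlevel2 /measurable_ysection -/(_ u).
by congr measurable; apply/seteqP; split=> x; rewrite /ysection/= inE.
Qed.

Lemma superlevel_mono F u v : 0 < u -> u <= v -> superlevel F v `<=` superlevel F u.
Proof.
by move=> u0 uv x [v0 vF]; split=> //; apply: le_trans vF; rewrite lee_fin.
Qed.

Variable m : {sigma_finite_measure set T -> \bar R}.

Lemma measurable_measure_superlevel F : measurable_fun setT F ->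
  measurable_fun setT (fun u : measurableTypeR R => m (superlevel F u)).
Proof.
move=> /measurable_superlevel2 mF.
have := measurable_fun_ysection m mF; congr measurable_fun.
apply/funext => u /=; congr (m _).
by apply/seteqP; split=> x; rewrite /ysection/= inE.
Qed.

Lemma layer_cake F : measurable_fun setT F -> (forall x, 0 <= F x)%E ->
  (\int[m]_x F x = \int[lebesgue_measure]_u m (superlevel F u))%E.
Proof.
move=> mF F0.
have mE := measurable_superlevel2 mF.
have := indic_fubini_tonelli m (@lebesgue_measure R) mE.
rewrite indic_fubini_tonelli_FE// indic_fubini_tonelli_GE// => h.
apply: (etrans (etrans _ h)).
- apply: eq_integral => x _ /=.
  have xE : xsection [set z : T * measurableTypeR R | superlevel F z.2 z.1] x =
      [set u : R | 0 < u /\ (u%:E <= F x)%E].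
    by apply/seteqP; split=> u; rewrite /xsection/= inE.
  rewrite xE; have := F0 x; case: (F x) => [r r0| _|//].
    rewrite (_ : [set _ | _] = `]0, r]%classic); last first.
      by apply/seteqP; split=> u /=; rewrite in_itv/= lee_fin => /andP.
    rewrite lebesgue_measure_itv/= lte_fin; case: ltgtP r0 => [||<-//].
      by rewrite sube0.
    by move=> r0 /(lt_le_trans r0); rewrite ltxx.
  rewrite (_ : [set _ | _] = `]0, +oo[%classic); last first.
    by apply/seteqP; split=> u /=; rewrite in_itv/= andbT ?leey// => -[].
  by rewrite lebesgue_measure_itv/= ltry.
- apply: eq_integral => u _ /=; congr (m _).
  by apply/seteqP; split=> x; rewrite /ysection/= inE.
Qed.

End superlevel.

Section lebesgue_line.
Context {R : realType}.
Local Notation mu := (@lebesgue_measure R).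
Implicit Types (A B C : set R).

Lemma measurable_affine (a b : R) :
  measurable_fun setT (fun x : R => (a * x + b)%R : measurableTypeR R).
Proof. by apply: measurable_funD => //; apply: measurable_funM. Qed.

Lemma lebesgue_measure_affine (a b : R) A : 0 < a -> measurable A ->
  (mu A = a%:E * mu [set x | A (a * x + b)%R])%E.
Proof.
move=> a0 mA.
pose m : {measure set (measurableTypeR R) -> \bar R} := mscale (NngNum (ltW a0))
  (measure_function_pushforward__canonical__measure_function_Measure
    (@lebesgue_measure R) (measurable_affine a b)).
suff h : forall X, ocitv X -> mu X = m X by exact: (lebesgue_measure_unique h mA).
move=> X [[x y] _ <-] /=.
rewrite /m /mscale/= /pushforward.
rewrite (_ : _ @^-1` _ = `](x - b) / a, (y - b) / a]%classic); last first.
  apply/seteqP; split=> z /=; rewrite !in_itv/= ltr_pdivrMr// ler_pdivlMr//;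
  by rewrite ltrBlDr lerBrDr mulrC.
rewrite !lebesgue_measure_itv/= !lte_fin ltr_pM2r ?invr_gt0// ltrD2r.
case: ifPn => _; last by rewrite mule0.
by rewrite -EFinB -EFinM; congr EFin; field; rewrite gt_eqF.
Qed.

Lemma integral_lebesgue_scale (a : R) (f : R -> \bar R) : 0 < a ->
  measurable_fun setT f -> (forall x, 0 <= f x)%E ->
  (\int[mu]_x f x = a%:E * \int[mu]_x f (a * x)%R)%E.
Proof.
move=> a0 mf f0.
pose m : {measure set (measurableTypeR R) -> \bar R} :=
  (measure_function_pushforward__canonical__measure_function_Measure
    (@lebesgue_measure R) (measurable_affine a 0)).
have -> : (\int[mu]_x f x = \int[mscale (NngNum (ltW a0)) m]_x f x)%E.
  by apply: eq_measure_integral => A mA _; exact: lebesgue_measure_affine.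
rewrite ge0_integral_mscale//=; congr (_ * _)%E.
rewrite ge0_integral_pushforward//; last exact: measurable_affine.
by rewrite preimage_setT; apply: eq_integral => x _ /=; rewrite addr0.
Qed.

Lemma measurable_preimage_affine (a b : R) A :
  measurable A -> measurable [set x | A (a * x + b)].
Proof.
by move=> mA; rewrite -[X in measurable X]setTI; exact: measurable_affine.
Qed.

(** With k = max K and l = min L, the translates K + l and k + L lie in the
    sumset and meet only at k + l, so the measures of K and L add up. *)
Lemma lebesgue_compact_sumset (K L C : set R) : compact K -> compact L ->
  K !=set0 -> L !=set0 -> measurable C ->
  (forall x y, K x -> L y -> C (x + y)) -> (mu K + mu L <= mu C)%E.
Proof.
move=> cK cL K0 L0 mC KLC.
have cid B : {within B, continuous (idfun : R -> R)}.
  by apply: continuous_subspaceT => x.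
have [k Kk kmax] := compact_EVT_max K0 cK (cid K).
have [l Ll lmin] := compact_EVT_min L0 cL (cid L).
have mK := compact_measurable cK; have mL := compact_measurable cL.
pose K' := [set x | K (1 * x + - l)].
pose L' := [set x | (L `\ l) (1 * x + - k)].
have mK' : measurable K' by exact: measurable_preimage_affine.
have mL' : measurable L'.
  by apply: measurable_preimage_affine; exact: measurableD.
have KE : mu K = mu K' by rewrite (lebesgue_measure_affine (- l) ltr01)// mul1e.
have LE : mu L = mu L'.
  rewrite (measureDI mu mL (measurable_set1 l)).
  rewrite [X in (_ + X)%E](_ : _ = 0%E); last first.
    apply/eqP; rewrite eq_le measure_ge0 andbT -(lebesgue_measure_set1 l).
    by apply: le_measure; rewrite ?inE//; exact: measurableI.
  rewrite adde0 -[RHS]mul1e; apply: (lebesgue_measure_affine (- k) ltr01).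
  exact: measurableD.
rewrite KE LE -measureU//.
  apply: le_measure; rewrite ?inE//; first exact: measurableU.
  have {}Kk := set_mem Kk; have {}Ll := set_mem Ll.
  move=> x []; rewrite /K' /L' /= mul1r; [move=> Kx|move=> [Lx _]].
    by rewrite -[x](subrK l); exact: KLC.
  by rewrite -[x](subrK k) addrC; exact: KLC.
apply/seteqP; split=> // x [Kx [Lx xl]].
move: Kx Lx xl; rewrite /K' /= !mul1r.
move=> /mem_set/kmax/= Kx /mem_set/lmin/= Lx; apply.
have -> : x = k + l by apply/eqP; rewrite eq_le -lerBlDr Kx addrC -lerBrDr.
by rewrite addrC addKr.
Qed.


(** Inner regularity reduces to compact sets. These are enlarged by a point of
    K and a point of L because an approximating compact set may be empty. *)
Lemma lebesgue_sumset (K L C : set R) : measurable K -> measurable L -> measurable C ->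
  K !=set0 -> L !=set0 ->
  (forall x y, K x -> L y -> C (x + y)) -> (mu K + mu L <= mu C)%E.
Proof.
move=> mK mL mC [x0 Kx0] [y0 Ly0] KLC.
have cmp P Q : compact P -> P `<=` K -> compact Q -> Q `<=` L ->
    (mu P + mu Q <= mu C)%E.
  move=> cP PK cQ QL.
  have cP' : compact (P `|` [set x0]) by apply: compactU => //; exact: compact_set1.
  have cQ' : compact (Q `|` [set y0]) by apply: compactU => //; exact: compact_set1.
  apply: le_trans (_ : mu (P `|` [set x0]) + mu (Q `|` [set y0]) <= _)%E.
    by apply: leeD; apply: le_measure; rewrite ?inE//;
      solve [exact: compact_measurable|exact: subsetUl].
  apply: lebesgue_compact_sumset => //; first by exists x0; right.
    by exists y0; right.
  by move=> x y [/PK Kx|->] [/QL Ly|->]; exact: KLC.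
have step Q : compact Q -> Q `<=` L -> (mu K + mu Q <= mu C)%E.
  move=> cQ QL.
  have fQ : mu Q \is a fin_num.
    by rewrite ge0_fin_numE ?measure_ge0//; exact: compact_finite_measure.
  rewrite -leeBrDr// lebesgue_regularity_inner_sup//.
  apply: ge_ereal_sup => _ [P [cP PK] <-].
  by rewrite leeBrDr//; exact: cmp.
have [fK|] := boolP (mu K \is a fin_num).
  rewrite addeC -leeBrDr// lebesgue_regularity_inner_sup//.
  apply: ge_ereal_sup => _ [Q [cQ QL] <-].
  by rewrite leeBrDr// addeC; exact: step.
rewrite ge0_fin_numE ?measure_ge0// -leNgt leye_eq => /eqP Koo.
have := step set0 (@compact0 _) (@sub0set _ _).
by rewrite measure0 adde0 Koo leye_eq => /eqP ->; rewrite leey.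
Qed.

Lemma brunn_minkowski_line (t : R) (K L C : set R) : 0 < t < 1 ->
  measurable K -> measurable L -> measurable C -> K !=set0 -> L !=set0 ->
  (forall x y, K x -> L y -> C ((1 - t) * x + t * y)) ->
  ((1 - t)%:E * mu K + t%:E * mu L <= mu C)%E.
Proof.
move=> /andP[t0 t1] mK mL mC K0 L0 KLC.
have s0 : 0 < 1 - t by rewrite subr_gt0.
have scaleE (c : R) A : 0 < c -> measurable A ->
    (c%:E * mu A = mu [set x | A (c^-1 * x + 0)%R])%E.
  move=> c0 mA; rewrite (@lebesgue_measure_affine c^-1 0 A) ?invr_gt0//.
  by rewrite muleA -EFinM divff ?gt_eqF// mul1e.
rewrite !scaleE//; apply: lebesgue_sumset => //.
- exact: measurable_preimage_affine.
- exact: measurable_preimage_affine.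
- by case: K0 => x Kx; exists ((1 - t) * x); rewrite /= mulKf ?gt_eqF// addr0.
- by case: L0 => x Lx; exists (t * x); rewrite /= mulKf ?gt_eqF// addr0.
- move=> x y /=; rewrite !addr0 => Kx Ly.
  by have := KLC _ _ Kx Ly; rewrite !mulVKf ?gt_eqF.
Qed.

End lebesgue_line.

(** * The Borell-Brascamp-Lieb inequality on the line *)

Section bbl_line.
Context {R : realType}.
Local Notation mu := (@lebesgue_measure R).

Lemma lee_of_lt_scale (x : R) (y : \bar R) : 0 < x ->
  (forall theta, 0 < theta < 1 -> ((theta * x)%:E <= y)%E) -> (x%:E <= y)%E.
Proof.
move=> x0 h; case: y h => [y| |] h; last 2 first.
- by rewrite leey.
- by have := h 2^-1; rewrite leeNy_eq/=; apply; lra.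
rewrite lee_fin leNgt; apply/negP => yx.
have [y0|y0] := leP y 0.
  have : 0 < (2^-1 : R) < 1 by lra.
  by move=> /h; rewrite lee_fin leNgt (le_lt_trans y0)// mulr_gt0.
have yx1 : y / x < 1 by rewrite ltr_pdivrMr// mul1r.
have yx0 : 0 < y / x by rewrite divr_gt0.
have : 0 < (y / x + 1) / 2 < 1 by lra.
move=> /h; rewrite lee_fin leNgt => /negP; apply.
rewrite -ltr_pdivrMr//; lra.
Qed.

Lemma integral_support d (T : measurableType d) (m : {measure set T -> \bar R})
    (D : set T) (f : T -> \bar R) : (forall x, ~ D x -> f x = 0)%E ->
  (\int[m]_x f x = \int[m]_(x in D) f x)%E.
Proof.
move=> f0; rewrite [RHS]integral_mkcond; apply: eq_integral => x _.
by rewrite patchE; case: ifPn => // /negP; rewrite inE => /f0.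
Qed.

(** The number A plays the role of the supremum of F: it is sup F if F is
    bounded, and a large integer otherwise, so that the levels below A keep
    more than the mass a. *)
Lemma truncated_layer_cake (F : R -> \bar R) (a : R) : measurable_fun setT F ->
  (forall x, 0 <= F x)%E -> 0 < a -> (a%:E < \int[mu]_x F x)%E ->
  exists A, [/\ 0 < A, forall u, 0 < u < A -> superlevel F u !=set0 &
    (a%:E < \int[mu]_(u in `]0%R, A[) mu (superlevel F u))%E].
Proof.
move=> mF F0 a0; rewrite layer_cake// => aF.
have mm := measurable_measure_superlevel mu mF.
set m := fun u => mu (superlevel F u) in mm aF *.
have m0 u : (0 <= m u)%E by exact: measure_ge0.
have mN u : ~ (superlevel F u !=set0) -> m u = 0%E.
  by move=> /set0P/negP/negPn/eqP E; rewrite /m E measure0.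
(* S is the interval of the levels that F reaches. *)
pose S := [set u | superlevel F u !=set0].
have Sdown u v : S v -> 0 < u -> u <= v -> S u.
  by move=> [x Sx] u0 uv; exists x; exact: superlevel_mono Sx.
have [[A ubA]|unb] := pselect (has_ubound S).
  have [v Sv] : S !=set0.
    apply: contrapT => S0; move: aF; rewrite integral0_eq ?lte_fin ?(lt_gtF a0)//.
    by move=> u _; apply: mN => Su; apply: S0; exists u.
  have supS : has_sup S by split; [exists v|exists A].
  exists (sup S); split.
  - case: (Sv) => x [v0 _]; apply: (lt_le_trans v0).
    exact: sup_upper_bound.
  - move=> u /andP[u0 uS]; have [w Sw uw] := sup_gt (ex_intro _ v Sv) uS.
    exact: Sdown Sw u0 (ltW uw).
  - rewrite integral_itv_bndo_bndc; last exact: measurable_funTS.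
    suff <- : (\int[mu]_u m u = \int[mu]_(u in `]0%R, sup S]) m u)%E by [].
    apply: integral_support => u /= uS; apply: mN => Su.
    apply: uS; rewrite in_itv/=; apply/andP; split; first by case: Su => x [].
    exact: sup_upper_bound.
have nS A : exists2 v, S v & A < v.
  apply: contrapT => h; apply: unb; exists A => v Sv; rewrite leNgt.
  by apply/negP => Av; apply: h; exists v.
pose D k := `]0%R, k.+1%:R[%classic : set R.
have Dnd : nondecreasing_seq D.
  move=> i j ij; rewrite subsetEset => u; rewrite /D/= !in_itv/= => /andP[-> /lt_le_trans]/=.
  by apply; rewrite ler_nat ltnS.
have UD : \bigcup_k D k = `]0%R, +oo[%classic.
  apply/seteqP; split=> [u [k _]|u]; rewrite /D/= !in_itv/= ?andbT.
    by case/andP.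
  move=> u0; exists (Num.truncn u) => //=; rewrite in_itv/= u0.
  exact: truncnS_gt.
have := @ge0_nondecreasing_set_cvg_integral _ (measurableTypeR R) R D m mu Dnd.
move=> /(_ (fun i => measurable_itv _) (fun i => measurable_funTS mm)
  (fun i x _ => m0 x)).
rewrite UD (_ : \int[mu]_(u in `]0%R, +oo[) m u = \int[mu]_u m u)%E; last first.
  apply/esym/integral_support => u; rewrite /= in_itv/= andbT => u0; apply: mN => -[x [u1 _]].
  exact: u0.
move=> cvg; have [k ak] : exists k, (a%:E < \int[mu]_(u in D k) m u)%E.
  apply: contrapT => h; move: aF; apply/negP; rewrite -leNgt.
  rewrite -(cvg_lim _ cvg)//; apply: lime_le; first by apply/cvg_ex; eexists; exact: cvg.
  by apply: nearW => k; rewrite leNgt; apply/negP => ak; apply: h; exists k.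
exists k.+1%:R; split => //.
move=> u /andP[u0 _]; have [v Sv uv] := nS u; exact: Sdown Sv u0 (ltW uv).
Qed.

(** Let A and B be the suprema of F and G, truncated if infinite, and let
    M be their mean of order ga. By homogeneity of the mean, the superlevel set
    of H at M w contains the Minkowski combination of those of F at A w and of
    G at B w, for 0 < w < 1. Brunn-Minkowski on the line and integration over
    w give
      \int H >= M ((1 - t) a / A + t b / B),
    and power_mean_hoelder with be = 1 bounds the right-hand side below by the
    mean of a and b of order ga / (1 + ga).
    The hypothesis and the conclusion speak of real numbers below F, G and
    their integrals; this form makes sense for extended-valued functions, and
    the hypothesis for sections is the conclusion one dimension lower. *)
Lemma borell_brascamp_lieb_line (t ga : R) (F G H : R -> \bar R) :
  0 < t < 1 -> -1 <= ga ->
  measurable_fun setT F -> measurable_fun setT G -> measurable_fun setT H ->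
  (forall x, 0 <= F x)%E -> (forall x, 0 <= G x)%E -> (forall x, 0 <= H x)%E ->
  (forall x y u v, 0 < u -> 0 < v -> (u%:E <= F x)%E -> (v%:E <= G y)%E ->
    ((power_mean t ga%:E u v)%:E <= H ((1 - t) * x + t * y)%R)%E) ->
  forall a b, 0 < a -> 0 < b ->
    (a%:E <= \int[mu]_x F x)%E -> (b%:E <= \int[mu]_x G x)%E ->
    ((power_mean t (if ga == -1 then -oo%E else (ga / (1 + ga))%:E) a b)%:E <=
      \int[mu]_x H x)%E.
Proof.
move=> t01 ga1 mF mG mH F0 G0 H0 dom.
set r := if _ then _ else _.
have roo : (r < +oo)%E by rewrite /r; case: ifP => _ //; rewrite ltry.
(* Truncation loses some mass; the mean being homogeneous, it is enough to
   treat theta a and theta b for theta < 1. *)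
suff strict a b : 0 < a -> 0 < b ->
    (a%:E < \int[mu]_x F x)%E -> (b%:E < \int[mu]_x G x)%E ->
    ((power_mean t r a b)%:E <= \int[mu]_x H x)%E.
  move=> a b a0 b0 aF bG; apply: lee_of_lt_scale; first exact: power_mean_gt0.
  move=> theta /andP[th0 th1]; rewrite -power_meanZ//; apply: strict.
  - exact: mulr_gt0.
  - exact: mulr_gt0.
  - by apply: lt_le_trans aF; rewrite lte_fin gtr_pMl.
  - by apply: lt_le_trans bG; rewrite lte_fin gtr_pMl.
move=> a0 b0 aF bG.
have [A [A0 FA aA]] := truncated_layer_cake mF F0 a0 aF.
have [B [B0 GB bB]] := truncated_layer_cake mG G0 b0 bG.
have mmF := measurable_measure_superlevel mu mF.
have mmG := measurable_measure_superlevel mu mG.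
have mmH := measurable_measure_superlevel mu mH.
set M := power_mean t ga%:E A B.
have M0 : 0 < M by apply: power_mean_gt0 => //; rewrite ltry.
have [t0 t1] := andP t01.
have s0 : 0 < 1 - t by rewrite subr_gt0.
pose pF := (fun u => mu (superlevel F u)) \_ `]0%R, A[.
pose pG := (fun u => mu (superlevel G u)) \_ `]0%R, B[.
have mpF : measurable_fun setT pF.
  by apply/(measurable_restrictT _ _).1 => //; exact: measurable_funTS.
have mpG : measurable_fun setT pG.
  by apply/(measurable_restrictT _ _).1 => //; exact: measurable_funTS.
have pF0 u : (0 <= pF u)%E by apply: erestrict_ge0 => v _; exact: measure_ge0.
have pG0 u : (0 <= pG u)%E by apply: erestrict_ge0 => v _; exact: measure_ge0.
have mscal (c : R) (f : R -> \bar R) : measurable_fun setT f ->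
    measurable_fun setT (fun w : R => f (c * w)).
  by move=> mf; apply: measurableT_comp => //; exact: measurable_funM.
have low (c z : R) (f : R -> \bar R) : 0 < c -> measurable_fun setT f ->
    (forall x, 0 <= f x)%E -> (z%:E < \int[mu]_x f x)%E ->
    ((z / c)%:E <= \int[mu]_w f (c * w)%R)%E.
  move=> c0 mf f0; rewrite (integral_lebesgue_scale c0)// => /ltW.
  by rewrite mulrC EFinM lee_pdivrMl.
have lowF : ((a / A)%:E <= \int[mu]_w pF (A * w)%R)%E.
  by apply: low => //; rewrite -integral_mkcond.
have lowG : ((b / B)%:E <= \int[mu]_w pG (B * w)%R)%E.
  by apply: low => //; rewrite -integral_mkcond.
rewrite (layer_cake mu mH H0) (integral_lebesgue_scale M0)//.
apply: (@le_trans _ _ (M%:E * \int[mu]_w ((1 - t)%:E * pF (A * w)%R + t%:E * pG (B * w)%R))%E).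
  rewrite ge0_integralD//; last 4 first.
  - by move=> w _; rewrite mule_ge0// lee_fin ltW.
  - by apply: measurable_funeM; exact: mscal.
  - by move=> w _; rewrite mule_ge0// lee_fin ltW.
  - by apply: measurable_funeM; exact: mscal.
  rewrite !ge0_integralZl_EFin//; try exact: mscal; try exact: ltW.
  apply: (@le_trans _ _ ((M * ((1 - t) * (a / A) + t * (b / B)))%:E)%E).
    rewrite lee_fin.
    have aA0 : 0 < a / A by rewrite divr_gt0.
    have bB0 : 0 < b / B by rewrite divr_gt0.
    have := @power_mean_hoelder R t ga 1 A (a / A) B (b / B) t01 ltr01.
    rewrite invr1 mul1r !powRr1 ?(ltW aA0) ?(ltW bB0) ?(ltW (wmean_gt0 t01 aA0 bB0))//.
    rewrite (mulrC A (a / A)) (mulrC B (b / B)) !divfK ?(lt0r_neq0 A0) ?(lt0r_neq0 B0)//.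
    by move=> h; exact: h.
  rewrite EFinM lee_pmul2l// EFinD !EFinM.
  by apply: leeD; rewrite lee_pmul2l// -EFinM.
rewrite lee_pmul2l//; apply: ge0_le_integral => //.
- by move=> w _; rewrite adde_ge0// mule_ge0// lee_fin ltW.
- by apply: emeasurable_funD; apply: measurable_funeM; exact: mscal.
- exact: (mscal M (fun u => mu (superlevel H u))).
move=> w _.
have pos (c : R) : 0 < c -> ((c * w)%R \in `]0%R, c[%classic) = (0 < w < 1).
  by move=> c0; rewrite mem_setE in_itv/= pmulr_rgt0// gtr_pMr.
rewrite /pF /pG !patchE !pos//; case: ifPn => [/andP[w0 w1]|_]; last first.
  by rewrite !mule0 adde0 measure_ge0.
apply: brunn_minkowski_line => //.
- exact: measurable_superlevel.
- exact: measurable_superlevel.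
- exact: measurable_superlevel.
- by apply: FA; rewrite mulr_gt0// gtr_pMr.
- by apply: GB; rewrite mulr_gt0// gtr_pMr.
move=> x y [u0 uF] [v0 vG]; split; first exact: mulr_gt0.
by rewrite mulrC /M -power_meanZ// ![w * _]mulrC; exact: dom.
Qed.

End bbl_line.

(** * Integration and the Prekopa-Leindler inequality in dimension n *)

Section lebesgue_rV_integral.
Context {R : realType}.
Local Notation mu := (@lebesgue_measure R).

Lemma measurable_comp_cons_rV n (F : 'rV[R]_n.+1 -> \bar R) :
  measurable_fun setT F ->
  measurable_fun setT (fun z : measurableTypeR R * 'rV[R]_n => F (cons_rV z)).
Proof. by move=> mF; apply: measurableT_comp => //; exact: measurable_cons_rV. Qed.

Lemma measurable_section_rV n (F : 'rV[R]_n.+1 -> \bar R) (x : R) :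
  measurable_fun setT F ->
  measurable_fun setT (fun v : 'rV[R]_n => F (cons_rV (x, v))).
Proof.
move=> /measurable_comp_cons_rV mF.
exact: (measurableT_comp mF (pair1_measurable (x : measurableTypeR R))).
Qed.

Lemma measurable_integral_rV n (F : 'rV[R]_n.+1 -> \bar R) :
  measurable_fun setT F -> (forall v, 0 <= F v)%E ->
  measurable_fun setT (fun x : measurableTypeR R =>
    \int[lebesgue_rV n]_v F (cons_rV (x, v)))%E.
Proof.
move=> /measurable_comp_cons_rV mF F0.
exact: (@measurable_fun_fubini_tonelli_F _ _ _ _ R (lebesgue_rV n) _ mF).
Qed.

Lemma integral_rVS n (F : 'rV[R]_n.+1 -> \bar R) :
  measurable_fun setT F -> (forall v, 0 <= F v)%E ->
  (\int[lebesgue_rV n.+1]_v F v =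
   \int[mu]_x \int[lebesgue_rV n]_v F (cons_rV (x, v)))%E.
Proof.
move=> mF F0.
pose m := measure_function_pushforward__canonical__measure_function_Measure
  (mu \x lebesgue_rV n)%E (@measurable_cons_rV R n).
have -> : (\int[lebesgue_rV n.+1]_v F v = \int[m]_v F v)%E.
  by apply: eq_measure_integral => A mA _.
rewrite ge0_integral_pushforward//; last exact: measurable_cons_rV.
rewrite preimage_setT.
exact: (@fubini_tonelli1 _ _ _ _ R mu (lebesgue_rV n) _ (measurable_comp_cons_rV mF)).
Qed.

Lemma scale_cons_rV n (c x : R) (v : 'rV[R]_n) :
  c *: cons_rV (x, v) = cons_rV (c * x, c *: v).
Proof.
apply/rowP => i; rewrite mxE; case: (unliftP ord0 i) => [j|] ->.
  by rewrite !cons_rVS/= mxE.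
by rewrite !cons_rV0.
Qed.

Lemma add_cons_rV n (x y : R) (v w : 'rV[R]_n) :
  cons_rV (x, v) + cons_rV (y, w) = cons_rV (x + y, v + w).
Proof.
apply/rowP => i; rewrite mxE; case: (unliftP ord0 i) => [j|] ->.
  by rewrite !cons_rVS/= mxE.
by rewrite !cons_rV0.
Qed.

Lemma measurable_scale_rV n (c : R) :
  measurable_fun setT (fun v : 'rV[R]_n => c *: v).
Proof.
apply: (measurability (@open 'rV[R]_n)) => // _ [U oU <-].
rewrite setTI; apply: open_measurable_rV.
by apply: open_comp => // x _; apply: scaler_continuous.
Qed.

Lemma measurable_comp_scale_rV n (c : R) (F : 'rV[R]_n -> \bar R) :
  measurable_fun setT F -> measurable_fun setT (fun v : 'rV[R]_n => F (c *: v)).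
Proof. by move=> mF; apply: measurableT_comp => //; exact: measurable_scale_rV. Qed.

Lemma integral_rV0 (F : 'rV[R]_0 -> \bar R) : measurable_fun setT F ->
  (\int[lebesgue_rV 0]_v F v = F 0%R)%E.
Proof. by move=> mF; rewrite integral_dirac// diracT mul1e. Qed.

Lemma integral_rV_scale n (c : R) (F : 'rV[R]_n -> \bar R) : 0 < c ->
  measurable_fun setT F -> (forall v, 0 <= F v)%E ->
  (\int[lebesgue_rV n]_v F v =
    (c ^+ n)%:E * \int[lebesgue_rV n]_v F (c *: v)%R)%E.
Proof.
move=> c0; elim: n F => [|n IH] F mF F0.
  rewrite !integral_rV0//; last exact: measurable_comp_scale_rV.
  by rewrite expr0 mul1e scaler0.
rewrite !integral_rVS//; last exact: measurable_comp_scale_rV.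
rewrite (integral_lebesgue_scale c0)//; last 2 first.
- exact: measurable_integral_rV.
- by move=> x; exact: integral_ge0.
rewrite exprS EFinM -muleA; congr (_ * _)%E.
rewrite -ge0_integralZl_EFin//; last 3 first.
- by move=> x _; exact: integral_ge0.
- apply: (@measurable_integral_rV n (fun w => F (c *: w))) => //.
  exact: measurable_comp_scale_rV.
- by rewrite exprn_ge0// ltW.
apply: eq_integral => x _.
rewrite IH//; last exact: measurable_section_rV.
by congr (_ * _)%E; apply: eq_integral => v _; rewrite scale_cons_rV.
Qed.

(** Induction on the dimension: by the induction hypothesis the integrals over
    the hyperplanes with fixed first coordinate satisfy the hypothesis of the
    one-dimensional inequality of order 0, and 0 / (1 + 0) = 0. *)
Lemma prekopa_leindler_rV n (s : R) (F G H : 'rV[R]_n -> \bar R) :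
  0 < s < 1 ->
  measurable_fun setT F -> measurable_fun setT G -> measurable_fun setT H ->
  (forall x, 0 <= F x)%E -> (forall x, 0 <= G x)%E -> (forall x, 0 <= H x)%E ->
  (forall x y u v, 0 < u -> 0 < v -> (u%:E <= F x)%E -> (v%:E <= G y)%E ->
    ((power_mean s 0%:E u v)%:E <= H ((1 - s) *: x + s *: y)%R)%E) ->
  forall a b, 0 < a -> 0 < b ->
    (a%:E <= \int[lebesgue_rV n]_x F x)%E ->
    (b%:E <= \int[lebesgue_rV n]_x G x)%E ->
    ((power_mean s 0%:E a b)%:E <= \int[lebesgue_rV n]_x H x)%E.
Proof.
move=> s01; elim: n F G H => [|n IH] F G H mF mG mH F0 G0 H0 dom a b a0 b0.
  rewrite !integral_rV0// => aF bG.
  by have := dom 0 0 a b a0 b0 aF bG; rewrite !scaler0 addr0.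
rewrite !integral_rVS// => aF bG.
have := @borell_brascamp_lieb_line R s 0
  (fun x => \int[lebesgue_rV n]_v F (cons_rV (x, v)))%E
  (fun x => \int[lebesgue_rV n]_v G (cons_rV (x, v)))%E
  (fun x => \int[lebesgue_rV n]_v H (cons_rV (x, v)))%E s01.
rewrite lerN10 mul0r => /(_ isT).
have -> : (0 == -1 :> R) = false by rewrite eq_sym oppr_eq0 oner_eq0.
apply => //; try exact: measurable_integral_rV;
  try by move=> x; exact: integral_ge0.
move=> x y u v u0 v0 uF vG.
apply: (IH (fun w => F (cons_rV (x, w))) (fun w => G (cons_rV (y, w)))) => //;
  try exact: measurable_section_rV.
move=> w z u' v' u'0 v'0 uF' vG'.
by have := dom _ _ _ _ u'0 v'0 uF' vG'; rewrite !scale_cons_rV add_cons_rV.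
Qed.

End lebesgue_rV_integral.

(** * Homogeneous convex functions *)

Section potential.
Context {R : realType} {n : nat}.
Variables (p : R) (V : 'rV[R]_n -> R).
Hypotheses (p1 : 1 < p) (V0 : forall x, 0 <= V x) (Vp : p_homogeneous p V)
  (Vc : convex_function [set: convex_lmodType 'rV[R]_n] V).

Let p0 : 0 < p. Proof. exact: lt_trans p1. Qed.

Lemma convex_ineq (s : R) x y : 0 <= s <= 1 ->
  V (s *: x + (1 - s) *: y) <= s * V x + (1 - s) * V y.
Proof.
move=> /andP[s0 s1].
exact: (Vc (Itv01 s0 s1) (mem_set (I : setT (x : convex_lmodType _)))
  (mem_set (I : setT (y : convex_lmodType _)))).
Qed.

Let Vz : V 0 = 0.
Proof. by rewrite -(scale0r (0 : 'rV[R]_n)) Vp// powR0 ?mul0r// gt_eqF. Qed.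

(* A crude quasi-triangle inequality: V (x + y) = 2^p V ((x + y) / 2). *)
Let V_add x y : V (x + y) <= 2 `^ p * (V x + V y).
Proof.
have h01 : 0 <= (2^-1 : R) <= 1 by lra.
have := convex_ineq x y h01.
rewrite (_ : 1 - 2^-1 = 2^-1); last by lra.
rewrite -scalerDr -mulrDr => h.
have -> : x + y = 2 *: (2^-1 *: (x + y)).
  by rewrite scalerA divff// scale1r.
rewrite Vp// ler_wpM2l ?powR_ge0//; apply: le_trans h _.
by rewrite ler_piMl ?addr_ge0//; lra.
Qed.

Let V_axis (e : 'rV[R]_n) (c : R) : `|c| <= 1 -> V (c *: e) <= V e + V (- e).
Proof.
move=> c1.
have cp : `|c| `^ p <= 1.
  rewrite -[leRHS](powRr0 `|c|); have [->|c0] := eqVneq c 0.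
    by rewrite normr0 powRr0 powR0 ?ler01// gt_eqF.
  by apply: ger_powR; rewrite ?normr_gt0 ?c0//= ltW.
have [c0|c0] := leP 0 c.
  rewrite -{1}(ger0_norm c0) Vp//; apply: (@le_trans _ _ (V e)).
    by rewrite ler_piMl.
  by rewrite lerDl.
have -> : c *: e = `|c| *: (- e) by rewrite ltr0_norm// scalerN scaleNr opprK.
rewrite Vp//; apply: (@le_trans _ _ (V (- e))).
  by rewrite ler_piMl.
by rewrite lerDr.
Qed.

Let V_bounded : exists2 M : R, 0 <= M &
  forall x : 'rV[R]_n, (forall i, `|x ord0 i| <= 1) -> V x <= M.
Proof.
suff [M M0 h] : exists2 M : R, 0 <= M & forall x : 'rV[R]_n,
    (forall i, `|x ord0 i| <= 1) ->
    V (\sum_(j <- index_enum 'I_n) x ord0 j *: delta_mx 0 j) <= M.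
  by exists M => // x x1; rewrite [x in V x]row_sum_delta; exact: h.
elim: (index_enum _) => [|j r [M M0 IH]].
  by exists 0 => // x _; rewrite big_nil Vz.
exists (2 `^ p * (V (delta_mx 0 j) + V (- delta_mx 0 j) + M)).
  by rewrite mulr_ge0 ?powR_ge0// !addr_ge0.
move=> x x1; rewrite big_cons; apply: le_trans (V_add _ _) _.
by rewrite ler_wpM2l ?powR_ge0// lerD//; [exact: V_axis|exact: IH].
Qed.

(* With V <= M on the unit cube, y = a (x / a) + (1 - a) (dl z) with z in the
   cube gives V y <= a^(1 - p) V x + dl^p M. Below, a is so close to 1 that
   a^(1 - p) = w makes the first term at most V x + eta, and dl is so small
   that the second one is at most eta. *)
Let V_usc (c : R) : open [set x | V x < c].
Proof.
have [M M0 VM] := V_bounded.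
rewrite openE => x /= Vxc.
pose eta := (c - V x) / 3.
have eta0 : 0 < eta by rewrite divr_gt0// subr_gt0.
pose w := 1 + eta / (V x + 1).
have w1 : 1 < w by rewrite ltrDl divr_gt0// ltr_wpDl.
have w0 : 0 < w := lt_trans ltr01 w1.
pose b := w `^ (p - 1)^-1.
have q0 : 0 < p - 1 by rewrite subr_gt0.
have b0 : 0 < b by exact: powR_gt0.
have b1 : 1 < b.
  have := @gt0_ltr_powR R (p - 1)^-1; rewrite invr_gt0 => /(_ q0 1 w).
  by rewrite !nnegrE ler01 (ltW w0) powR1 => /(_ isT isT w1).
pose a := b^-1.
have a0 : 0 < a by rewrite invr_gt0.
have a1 : a < 1 by rewrite invf_lt1.
pose dl := (eta / (M + 1)) `^ p^-1.
have M1 : 0 < M + 1 by rewrite ltr_wpDl.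
have dl0 : 0 < dl by rewrite powR_gt0// divr_gt0.
have dlM : dl `^ p * M <= eta.
  rewrite /dl -powRrM mulVf ?gt_eqF// powRr1 ?(ltW (divr_gt0 eta0 M1))//.
  by rewrite mulrAC ler_pdivrMr// ler_pM2l// lerDl.
have e0 : 0 < dl * (1 - a) by rewrite mulr_gt0// subr_gt0.
change (nbhs x [set x | V x < c]); apply/nbhs_ballP.
exists (dl * (1 - a)) => //= y [_ xy] /=.
pose z := (dl * (1 - a))^-1 *: (y - x).
have Vz' : V z <= M.
  apply: VM => i; rewrite !mxE normrM ger0_norm ?invr_ge0 ?(ltW e0)//.
  rewrite ler_pdivrMl// mulr1 ltW//.
  have := xy ord0 i.
  by rewrite -ball_normE/= distrC.
have -> : y = a *: (b *: x) + (1 - a) *: (dl *: z).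
  rewrite !scalerA mulVf ?gt_eqF// scale1r.
  rewrite [(1 - a) * dl]mulrC divff ?gt_eqF// scale1r.
  by rewrite addrC subrK.
have a01 : 0 <= a <= 1 by rewrite !ltW.
apply: le_lt_trans (convex_ineq _ _ a01) _; rewrite (Vp x (ltW b0)) (Vp z (ltW dl0)).
have abw : a * b `^ p = w.
  rewrite /a -(mulr_powRB1 (ltW b0) p0) mulrA mulVf ?gt_eqF// mul1r.
  by rewrite /b -powRrM mulVf ?gt_eqF// powRr1// ltW.
rewrite mulrA abw.
have h1 : w * V x <= V x + eta.
  rewrite /w mulrDl mul1r lerD2l mulrAC ler_pdivrMr ?ltr_wpDl//.
  by rewrite ler_pM2l// lerDl.
have h2 : (1 - a) * (dl `^ p * V z) <= eta.
  apply: le_trans dlM; apply: (@le_trans _ _ (dl `^ p * V z)).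
    by rewrite ler_piMl ?mulr_ge0 ?powR_ge0// gerBl ltW.
  by rewrite ler_wpM2l ?powR_ge0.
apply: le_lt_trans (lerD h1 h2) _.
have cE : c = V x + eta + eta + eta by rewrite /eta; field.
by rewrite [ltRHS]cE ltrDl.
Qed.

(** A homogeneous convex function is upper semicontinuous, hence Borel. *)
Lemma measurable_potential : measurable_fun setT V.
Proof.
apply: (measurability (@RGenInftyO.G R)); first exact: RGenInftyO.measurableE.
move=> _ [_ [c ->] <-]; rewrite setTI; apply: open_measurable_rV.
have : open [set x | V x < c] by exact: V_usc.
by congr open; apply/seteqP; split=> x /=; rewrite in_itv.
Qed.

End potential.

(** * An entropy inequality *)

Section scalar_inequality.
Context {R : realType}.
Variable p : R.
Hypothesis p1 : 1 < p.
Implicit Types (t x y z : R).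

Let p0 : 0 < p. Proof. exact: lt_trans p1. Qed.

Let one_powR (q : R) : 1 `^ q = 1. Proof. by rewrite powR1. Qed.

(** Concavity, from the mean value theorem on both sides of the intermediate
    point. It is stated with the endpoint 1 because the derivative in question
    is decreasing only up to 1. *)
Lemma wmean1_le_of_derive_anti (f df : R -> R) t x :
  (forall y, 0 < y -> is_derive y 1 f (df y)) ->
  (forall y z, 0 < y -> y <= z -> z <= 1 -> df z <= df y) ->
  0 < t < 1 -> 0 < x <= 1 ->
  (1 - t) * f x + t * f 1 <= f ((1 - t) * x + t).
Proof.
move=> fdf df_anti /andP[t0 t1] /andP[x0].
rewrite le_eqVlt => /predU1P[->|x1].
  by rewrite mulr1 subrK -mulrDl subrK mul1r.
set m := _ + t.
have xm : x < m.
  by rewrite /m -subr_gt0 (_ : _ - _ = t * (1 - x)); [rewrite mulr_gt0 ?subr_gt0|ring].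
have m1 : m < 1.
  by rewrite /m -subr_gt0 (_ : _ - _ = (1 - t) * (1 - x)); [rewrite mulr_gt0 ?subr_gt0|ring].
have mvt a b : 0 < a -> a < b ->
    exists2 c, c \in `]a, b[%R & f b - f a = df c * (b - a).
  move=> a0 ab; apply: MVT => // [z|].
    by rewrite in_itv/= => /andP[az _]; apply: fdf; exact: lt_trans az.
  apply: derivable_within_continuous => z; rewrite in_itv/= => /andP[az _].
  by have [] := fdf z (lt_le_trans a0 az).
have [c + cE] := mvt _ _ x0 xm; rewrite in_itv/= => /andP[xc cm].
have [d + dE] := mvt _ _ (lt_trans x0 xm) m1; rewrite in_itv/= => /andP[md d1].
have cd : df d <= df c.
  by apply: df_anti; [exact: lt_trans xc|apply/ltW/(lt_trans cm)|exact: ltW].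
rewrite -subr_ge0.
have -> : f m - ((1 - t) * f x + t * f 1) =
    (1 - t) * (f m - f x) - t * (f 1 - f m) by ring.
rewrite cE dE.
have -> : (1 - t) * (df c * (m - x)) - t * (df d * (1 - m)) =
    (t * (1 - t) * (1 - x)) * (df c - df d) by rewrite /m; ring.
by rewrite mulr_ge0 ?subr_ge0// !mulr_ge0 ?subr_ge0 ?ltW.
Qed.

Lemma is_derive_expRN_powR y : 0 < y ->
  is_derive y 1 (fun z : R => expR (- ((p - 1) / p * z `^ p)))
    (expR (- ((p - 1) / p * y `^ p)) * - ((p - 1) * y `^ (p - 1))).
Proof.
move=> y0.
have -> : - ((p - 1) * y `^ (p - 1)) = - ((p - 1) / p) * (p * y `^ (p - 1)).
  by rewrite mulNr mulrA divfK ?(gt_eqF p0).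
have -> : (fun z : R => expR (- ((p - 1) / p * z `^ p))) =
    expR \o (fun z => (- ((p - 1) / p)) *: (z `^ p : R^o)).
  by apply/funext => z /=; rewrite -mulNr.
rewrite -[X in expR X]mulNr.
apply: is_derive1_comp.
by apply: is_deriveZ; exact: is_derive1_powR.
Qed.

(** Both sides are (p - 1)-st powers of y exp (- y^p / p), which increases up to
    y = 1: apply ln z <= z - 1 to z = (x / y)^p and use y^p <= 1. *)
Lemma le_powR_expRN x y : 0 < x -> x <= y -> y <= 1 ->
  expR (- ((p - 1) / p * x `^ p)) * x `^ (p - 1) <=
  expR (- ((p - 1) / p * y `^ p)) * y `^ (p - 1).
Proof.
move=> x0 xy y1; have y0 := lt_le_trans x0 xy.
have xyp : 0 < x / y by rewrite divr_gt0.
have h : ln x <= ln y + ((x / y) `^ p - 1) / p.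
  have := @le_ln1Dx R ((x / y) `^ p - 1).
  rewrite ltrBrDl subrr powR_gt0// => /(_ isT).
  rewrite addrC subrK ln_powR ln_div ?posrE//.
  by rewrite -ler_pdivlMl// mulrC lerBlDl.
have yp1 : y `^ p <= 1.
  by rewrite -[leRHS](one_powR p); apply: ge0_ler_powR; rewrite ?nnegrE ?(ltW p0) ?(ltW y0).
have xyE : (x / y) `^ p * y `^ p = x `^ p.
  by rewrite -powRM ?(ltW xyp) ?(ltW y0)// divfK ?gt_eqF.
have xy1 : (x / y) `^ p <= 1.
  rewrite -[leRHS](one_powR p); apply: ge0_ler_powR; rewrite ?nnegrE ?(ltW p0) ?(ltW xyp)//.
  by rewrite ler_pdivrMr// mul1r.
have h2 : ((x / y) `^ p - 1) / p <= (x `^ p - y `^ p) / p.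
  rewrite ler_pM2r ?invr_gt0// -xyE.
  rewrite -{2}(mul1r (y `^ p)) -mulrBl -[leLHS]mulr1.
  by apply: ler_wnM2l; rewrite ?subr_le0.
have h3 := le_trans h (lerD (lexx _) h2).
have qE z : 0 < z -> z `^ (p - 1) = expR ((p - 1) * ln z).
  by move=> z0; rewrite /powR (gt_eqF z0).
rewrite (qE x x0) (qE y y0) -!expRD ler_expR.
have p1' : 0 <= p - 1 by rewrite subr_ge0 ltW.
have := ler_wpM2l p1' h3.
have -> : (p - 1) * (ln y + (x `^ p - y `^ p) / p) =
  (p - 1) * ln y + (p - 1) / p * x `^ p - (p - 1) / p * y `^ p by ring.
set a := (p - 1) * ln x; set b := (p - 1) * ln y.
set u := (p - 1) / p * x `^ p; set v := (p - 1) / p * y `^ p.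
clearbody a b u v; clear; lra.
Qed.

(** The function exp (- (p - 1) / p y^p) is concave on [0, 1]; this is where the
    effective dimension n p / (p - 1) comes from. *)
Lemma concave_expRN_powR t x : 0 < t < 1 -> 0 < x <= 1 ->
  (1 - t) * expR (- ((p - 1) / p * x `^ p)) + t * expR (- ((p - 1) / p)) <=
  expR (- ((p - 1) / p * ((1 - t) * x + t) `^ p)).
Proof.
move=> t01 x01.
have := @wmean1_le_of_derive_anti (fun z : R => expR (- ((p - 1) / p * z `^ p)))
  (fun y => expR (- ((p - 1) / p * y `^ p)) * - ((p - 1) * y `^ (p - 1)))
  t x is_derive_expRN_powR _ t01 x01.
rewrite one_powR mulr1; apply => y z y0 yz z1.
have neg (a b a' b' : R) : a * b <= a' * b' ->
    a' * - ((p - 1) * b') <= a * - ((p - 1) * b).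
  move=> h; rewrite !mulrN lerN2 !(mulrCA _ (p - 1)).
  by apply: ler_wpM2l => //; rewrite subr_ge0 ltW.
exact/neg/le_powR_expRN.
Qed.

Section entropy.
Variables (t s l mu : R).
Hypotheses (t01 : 0 < t < 1) (s01 : 0 < s < 1) (l0 : 0 < l) (mu0 : 0 < mu).
Hypotheses (sl : (1 - s) * l = 1 - t) (smu : s * mu = t).

Let t0 : 0 < t. Proof. by case/andP: t01. Qed.
Let t1 : 0 < 1 - t. Proof. by case/andP: t01 => _; rewrite subr_gt0. Qed.
Let s0 : 0 < s. Proof. by case/andP: s01. Qed.
Let s1 : 0 < 1 - s. Proof. by case/andP: s01 => _; rewrite subr_gt0. Qed.
Let s01' : 0 <= s <= 1. Proof. by rewrite (ltW s0)/= -subr_ge0 ltW. Qed.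

(** As l = (1 - t) / (1 - s) and mu = t / s, this is the relative entropy
    of the weights (1 - s, s) with respect to (1 - t, t). *)
Definition rel_entropy := - ((1 - s) * ln l + s * ln mu).

Lemma rel_entropy_ge0 : 0 <= rel_entropy.
Proof.
rewrite /rel_entropy oppr_ge0; apply: le_trans (ln_wmean_ge s01' l0 mu0) _.
by rewrite sl smu subrK ln1.
Qed.

(** The Gibbs variational inequality, that is, Jensen's inequality for ln with
    the weights 1 - s and s. *)
Lemma gibbs x y :
  - ((p - 1) / p) * ((1 - s) * x + s * y) - rel_entropy <=
  ln ((1 - t) * expR (- ((p - 1) / p * x)) + t * expR (- ((p - 1) / p * y))).
Proof.
have := ln_wmean_ge s01' (mulr_gt0 l0 (expR_gt0 (- ((p - 1) / p * x))))
  (mulr_gt0 mu0 (expR_gt0 (- ((p - 1) / p * y)))).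
rewrite !mulrA sl smu; apply: le_trans.
rewrite !lnM ?posrE ?expR_gt0// !expRK /rel_entropy.
rewrite le_eqVlt; apply/orP; left; apply/eqP; ring.
Qed.

Hypothesis l1 : l <= 1.

(** The numbers damp and amp describe where the bound for
    V ((1 - t) x + t y) by a combination of V x and V y is tight: when
    V^(1/p) is affine between x and y and takes there the values damp * amp
    and 1, up to a common factor. Its value at (1 - t) x + t y is then amp, as
    (1 - t) (damp * amp) + t = amp. *)
Definition damp := l `^ (p - 1)^-1.
Definition amp := t / (1 - (1 - t) * damp).

Let damp_gt0 : 0 < damp. Proof. exact: powR_gt0. Qed.

Let q0 : 0 < p - 1. Proof. by rewrite subr_gt0. Qed.

Let damp_le1 : damp <= 1.
Proof.
rewrite /damp -[leRHS](one_powR (p - 1)^-1); apply: ge0_ler_powR => //.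
- by rewrite invr_ge0 ltW.
- by rewrite nnegrE ltW.
- by rewrite nnegrE.
Qed.

Let den_ge : t <= 1 - (1 - t) * damp.
Proof.
rewrite -subr_ge0 (_ : _ - _ = (1 - t) * (1 - damp)); last by ring.
by rewrite mulr_ge0 ?subr_ge0// -subr_ge0 ltW.
Qed.

Let den_gt0 : 0 < 1 - (1 - t) * damp.
Proof. exact: lt_le_trans den_ge. Qed.

Lemma amp_gt0 : 0 < amp. Proof. by rewrite divr_gt0. Qed.

Let amp_le1 : amp <= 1.
Proof. by rewrite ler_pdivrMr// mul1r. Qed.

Let ampE : (1 - t) * (damp * amp) + t = amp.
Proof.
rewrite /amp; have := lt0r_neq0 den_gt0; move: damp => d d0; field.
by [].
Qed.

Let dampE : damp `^ (p - 1) = l.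
Proof. by rewrite /damp -powRrM mulVf ?gt_eqF// powRr1// ltW. Qed.

(** As ln c <= c - 1, it is enough to bound s (c - 1) with
    c = amp^(p - 1) mu. By the choice of damp and amp,
    s c = amp^p - (1 - s) (damp amp)^p. The concavity of
    exp (- (p - 1) / p y^p) between damp amp and 1 bounds
    amp^p = ((1 - t) (damp amp) + t)^p from above, and the Gibbs inequality
    turns the logarithm that appears into the relative entropy. *)
Lemma amp_entropy :
  s * ln (amp `^ (p - 1) * mu) <= p / (p - 1) * rel_entropy.
Proof.
have c0 : 0 < amp `^ (p - 1) * mu by rewrite mulr_gt0 ?powR_gt0 ?amp_gt0.
have xa : 0 < damp * amp <= 1.
  rewrite mulr_gt0 ?amp_gt0//= -[leRHS]mulr1.
  exact: ler_pM (ltW damp_gt0) (ltW amp_gt0) _ _.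
have := concave_expRN_powR t01 xa; rewrite ampE => h.
have := gibbs ((damp * amp) `^ p) 1; rewrite mulr1 [X in X * (_ + _) - _]/=.
have W0 : 0 < (1 - t) * expR (- ((p - 1) / p * (damp * amp) `^ p)) +
    t * expR (- ((p - 1) / p)).
  exact: (addr_gt0 (mulr_gt0 t1 (expR_gt0 _)) (mulr_gt0 t0 (expR_gt0 _))).
rewrite mulr1 => g; have {g}g := le_trans g (_ : _ <= - ((p - 1) / p * amp `^ p)).
have {g} : - ((p - 1) / p) * ((1 - s) * (damp * amp) `^ p + s) - rel_entropy <=
    - ((p - 1) / p * amp `^ p).
  apply: g; rewrite -[leRHS]expRK ler_ln ?posrE ?expR_gt0//.
have pp : amp `^ p - (1 - s) * (damp * amp) `^ p = s * (amp `^ (p - 1) * mu).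
  have pE z : 0 < z -> z `^ p = z `^ (p - 1) * z.
    by move=> z0; rewrite mulrC mulr_powRB1// ltW.
  rewrite powRM ?ltW ?amp_gt0// !pE ?amp_gt0// dampE.
  rewrite [s * _]mulrCA smu.
  have -> : amp `^ (p - 1) * amp - (1 - s) * (l * damp * (amp `^ (p - 1) * amp)) =
    amp `^ (p - 1) * (amp - ((1 - s) * l) * (damp * amp)) by ring.
  rewrite sl; congr (_ * _); apply/eqP; rewrite subr_eq addrC; apply/eqP.
  by rewrite ampE.
have lnc : s * ln (amp `^ (p - 1) * mu) <= s * (amp `^ (p - 1) * mu) - s.
  have := @le_ln1Dx R (amp `^ (p - 1) * mu - 1).
  rewrite ltrBrDl subrr c0 => /(_ isT); rewrite addrC subrK => h'.
  by have := ler_wpM2l (ltW s0) h'; rewrite mulrBr mulr1.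
move=> g; apply: le_trans lnc _; rewrite -pp.
set D := rel_entropy in g *.
have k0 : 0 < (p - 1) / p by rewrite divr_gt0.
have -> : p / (p - 1) * D = ((p - 1) / p)^-1 * D by rewrite invf_div.
move: k0 g; set k := (p - 1) / p => k0; clearbody k D => g.
by rewrite -ler_pdivrMl ?invr_gt0// invrK; lra.
Qed.

Lemma tangent_weights : exists d m, [/\ 0 < d, 0 < m,
  (1 - (1 - t) * d) * m = t, d `^ (p - 1) = l &
  s * ln (m `^ (p - 1) * mu) <= p / (p - 1) * rel_entropy].
Proof.
exists damp, amp; split => //; first exact: amp_gt0.
- by rewrite /amp mulrC divfK ?(gt_eqF den_gt0).
- exact: amp_entropy.
Qed.

End entropy.
End scalar_inequality.

(** * The Brunn-Minkowski inequality for star bodies *)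

Section star_bodies.
Context {R : realType} {n : nat}.
Variables (p : R) (V : 'rV[R]_n -> R).
Hypotheses (p1 : 1 < p) (V0 : forall x, 0 <= V x) (Vp : p_homogeneous p V)
  (Vc : convex_function [set: convex_lmodType 'rV[R]_n] V).
Implicit Types (K L C : set 'rV[R]_n) (c : R).

Let p0 : 0 < p. Proof. exact: lt_trans p1. Qed.
Let q0 : 0 < p - 1. Proof. by rewrite subr_gt0. Qed.

(** For c = 1 the integral of this function is the measure of K. *)
Definition damped c K (x : 'rV[R]_n) : \bar R :=
  (\1_K x * expR (- (c * V x)))%:E.

Let damped_ge0 c K x : (0 <= damped c K x)%E.
Proof. by rewrite lee_fin mulr_ge0 ?expR_ge0. Qed.

Let measurable_damped c K : measurable K -> measurable_fun setT (damped c K).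
Proof.
move=> mK; apply/measurable_EFinP; apply: measurable_funM.
  exact: measurable_indic.
apply: measurableT_comp; first exact: measurable_expR.
apply: measurableT_comp; first exact: oppr_measurable.
by apply: measurable_funM => //; exact: (measurable_potential p1 V0 Vp Vc).
Qed.

Let dampedP c K x u : 0 < u -> (u%:E <= damped c K x)%E ->
  K x /\ u <= expR (- (c * V x)).
Proof.
move=> u0; rewrite /damped lee_fin indicE; have [xK|xK] := boolP (x \in K).
  by rewrite mul1r; split => //; exact: set_mem.
by rewrite mul0r leNgt u0.
Qed.

(** Substitute k x for x: by homogeneity c V (k x) <= V x, and
    K contains k x whenever it contains x. *)
Lemma integral_damped_star c k K : star_body K -> 0 <= c -> 0 < k <= 1 ->
  c * k `^ p <= 1 ->
  ((k ^+ n)%:E * \int[lebesgue_rV n]_x damped 1 K x <=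
   \int[lebesgue_rV n]_x damped c K x)%E.
Proof.
move=> [mK sK] c0 /andP[k0 k1] ckp.
rewrite [leRHS](integral_rV_scale k0)//; last exact: measurable_damped.
apply: lee_wpmul2l; first by rewrite lee_fin exprn_ge0// ltW.
apply: ge0_le_integral => //.
- exact: measurable_damped.
- by apply: measurable_comp_scale_rV; exact: measurable_damped.
move=> x _; rewrite lee_fin; apply: ler_pM => //; rewrite ?expR_ge0//.
  rewrite !indicE ler_nat; have [xK|//] := boolP (x \in K).
  suff -> : (k *: x) \in K by [].
  have k01 : 0 <= k <= 1 by rewrite (ltW k0).
  by apply/mem_set/(sK k k01); exists x => //; exact: set_mem.
rewrite ler_expR lerN2 mul1r Vp ?(ltW k0)// mulrA.
by rewrite ler_piMl.
Qed.

Section one_sided.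
Variables (t s l mu : R).
Hypotheses (t01 : 0 < t < 1) (s01 : 0 < s < 1) (l0 : 0 < l) (mu0 : 0 < mu).
Hypotheses (sl : (1 - s) * l = 1 - t) (smu : s * mu = t) (l1 : l <= 1).

(** Convexity with the weights (1 - t) d and 1 - (1 - t) d at the points x / d
    and m y, combined with homogeneity. The weights are chosen to make the
    coefficient of V x equal to 1 - s, so that only y is damped. *)
Lemma potential_tangent d m : 0 < d -> 0 < m -> (1 - (1 - t) * d) * m = t ->
  d `^ (p - 1) = l -> forall x y,
  V ((1 - t) *: x + t *: y) <=
    (1 - s) * V x + s * (m `^ (p - 1) * mu) * V y.
Proof.
move=> d0 m0 dm dl x y.
have [t0 t1] := andP t01.
have s1 : 0 < 1 - t by rewrite subr_gt0.
have sg0 : 0 < 1 - (1 - t) * d by rewrite -(pmulr_lgt0 _ m0) dm.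
have sg1 : 0 <= (1 - t) * d <= 1.
  by rewrite mulr_ge0 ?(ltW s1) ?(ltW d0)//= -subr_ge0 ltW.
have := convex_ineq Vc (d^-1 *: x) (m *: y) sg1.
rewrite !scalerA dm mulfK ?gt_eqF// => h; apply: le_trans h _.
rewrite !Vp ?(ltW m0) ?invr_ge0 ?(ltW d0)// !mulrA.
have -> : (1 - t) * d * d^-1 `^ p = 1 - s.
  rewrite -(mulr_powRB1 _ p0) ?invr_ge0 ?(ltW d0)// mulrA mulfK ?gt_eqF//.
  rewrite -powR_inv1 ?(ltW d0)// -powRrM mulN1r powRN dl -sl.
  by rewrite mulfK ?gt_eqF.
have -> : (1 - (1 - t) * d) * m `^ p = s * m `^ (p - 1) * mu.
  by rewrite -(mulr_powRB1 (ltW m0) p0) mulrA dm mulrAC smu.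
by [].
Qed.

(** Prekopa-Leindler with the weight s, free to differ from t, applied to
    the dilates by l and mu of the damped indicators of K and L:
    (1 - s) (l x) + s (mu y) = (1 - t) x + t y. The dilations account for the
    powers of l and mu, and damping by c = m^(p - 1) mu costs L a factor k^n,
    where k = min(1, c^(-1/p)), by the star property. *)
Lemma star_prekopa_leindler (A B : R) K L C : star_body K -> star_body L ->
  measurable C -> (forall x y, K x -> L y -> C ((1 - t) *: x + t *: y)) ->
  0 < A -> 0 < B ->
  (A%:E <= \int[lebesgue_rV n]_x damped 1 K x)%E ->
  (B%:E <= \int[lebesgue_rV n]_x damped 1 L x)%E ->
  exists2 k, s * - ln k <= (p - 1)^-1 * rel_entropy s l mu /\ 0 < k &
  (((l ^+ n * A) `^ (1 - s) * ((mu * k) ^+ n * B) `^ s)%:E <=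
    \int[lebesgue_rV n]_x damped 1 C x)%E.
Proof.
move=> stK stL mC KLC A0 B0 AK BL.
have [mK _] := stK; have [mL _] := stL.
have [s0 s1] := andP s01.
have [d [m [d0 m0 dm dl ent]]] := tangent_weights p1 t01 s01 l0 mu0 sl smu l1.
set c := m `^ (p - 1) * mu in ent.
have c0 : 0 < c by rewrite mulr_gt0// powR_gt0.
pose k := Num.min 1 (c `^ - p^-1).
have k0 : 0 < k by rewrite lt_min ltr01 powR_gt0.
have k1 : k <= 1 by rewrite ge_min lexx.
have ckp : c * k `^ p <= 1.
  apply: (@le_trans _ _ (c * (c `^ - p^-1) `^ p)).
    rewrite ler_pM2l//; apply: ge0_ler_powR; rewrite ?nnegrE ?powR_ge0 ?(ltW p0) ?(ltW k0)//.
    by rewrite ge_min lexx orbT.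
  by rewrite -powRrM mulNr mulVf ?gt_eqF// powRN powRr1 ?(ltW c0)// divff ?gt_eqF.
exists k.
  split=> //; rewrite /k; case: (leP 1 (c `^ - p^-1)) => _.
    by rewrite ln1 oppr0 mulr0 mulr_ge0 ?invr_ge0 ?(ltW q0)// (rel_entropy_ge0 s01 l0 mu0 sl smu).
  rewrite ln_powR mulNr opprK mulrCA ler_pdivrMl//.
  by rewrite mulrA.
have geo u v : 0 < u -> 0 < v -> power_mean s 0%:E u v = u `^ (1 - s) * v `^ s.
  by move=> u0 v0; rewrite /power_mean mulf_eq0 (gt_eqF u0) (gt_eqF v0)/= eqxx.
have lA0 : 0 < l ^+ n * A by rewrite mulr_gt0// exprn_gt0.
have kB0 : 0 < (mu * k) ^+ n * B by rewrite mulr_gt0// exprn_gt0// mulr_gt0.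
rewrite -geo//.
pose F x := damped 1 K (l^-1 *: x).
pose G y := damped c L (mu^-1 *: y).
have mF : measurable_fun setT F.
  by apply: measurable_comp_scale_rV; exact: measurable_damped.
have mG : measurable_fun setT G.
  by apply: measurable_comp_scale_rV; exact: measurable_damped.
have FA : ((l ^+ n * A)%:E <= \int[lebesgue_rV n]_x F x)%E.
  rewrite (integral_rV_scale l0)//; last by move=> x; exact: damped_ge0.
  rewrite EFinM; apply: lee_wpmul2l; first by rewrite lee_fin exprn_ge0// ltW.
  apply: le_trans AK _; rewrite le_eqVlt; apply/orP; left; apply/eqP.
  by apply: eq_integral => x _; rewrite /F scalerA mulVf ?gt_eqF// scale1r.
have GB : (((mu * k) ^+ n * B)%:E <= \int[lebesgue_rV n]_x G x)%E.
  rewrite (integral_rV_scale mu0)//; last by move=> x; exact: damped_ge0.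
  rewrite exprMn -mulrA (EFinM (mu ^+ n)); apply: lee_wpmul2l.
    by rewrite lee_fin exprn_ge0// ltW.
  rewrite (_ : (fun x => G (mu *: x)) = damped c L); last first.
    by apply/funext => x; rewrite /G scalerA mulVf ?gt_eqF// scale1r.
  have k01 : 0 < k <= 1 by rewrite k0.
  apply: le_trans (integral_damped_star stL (ltW c0) k01 ckp).
  by rewrite EFinM; apply: lee_wpmul2l => //; rewrite lee_fin exprn_ge0// ltW.
apply: (@prekopa_leindler_rV R n s F G (damped 1 C) s01 mF mG
  (measurable_damped 1 mC) (fun x => damped_ge0 _ _ _)
  (fun x => damped_ge0 _ _ _) (damped_ge0 _ _) _ _ _ lA0 kB0 FA GB).
move=> x y u v u0 v0 /(dampedP u0)[Kx ux] /(dampedP v0)[Ly vy].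
have zE : (1 - s) *: x + s *: y =
    (1 - t) *: (l^-1 *: x) + t *: (mu^-1 *: y).
  by rewrite !scalerA -sl -smu !mulfK ?gt_eqF.
rewrite geo// /damped zE indicE mem_set; last exact: KLC.
rewrite mul1r lee_fin mul1r.
apply: (@le_trans _ _ (expR (- (1 * V (l^-1 *: x))) `^ (1 - s) *
  expR (- (c * V (mu^-1 *: y))) `^ s)).
  apply: ler_pM; rewrite ?powR_ge0//; apply: ge0_ler_powR;
    by rewrite ?nnegrE ?expR_ge0 ?subr_ge0 ?(ltW s0) ?(ltW s1) ?(ltW u0) ?(ltW v0).
rewrite -!expRM -expRD ler_expR mul1r.
have := potential_tangent d0 m0 dm dl (l^-1 *: x) (mu^-1 *: y).
rewrite -/c; lra.
Qed.

End one_sided.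

(** The effective dimension: the measure with density exp (- V) behaves on star
    bodies as Lebesgue measure does in this dimension. *)
Definition bm_dim : R := p * n%:R / (p - 1).

(** Taking s = t b / ((1 - t) a + t b) makes both l^N a^N and mu^N b^N equal to
    ((1 - t) a + t b)^N, with N = bm_dim. In the logarithm of the bound of
    star_prekopa_leindler, the excess N - n = n / (p - 1) of the exponent
    multiplies the relative entropy, and this pays for the damping. The
    assumption b <= a makes l <= 1. *)
Lemma star_brunn_minkowski_le (t a b : R) K L C : 0 < t < 1 ->
  star_body K -> star_body L -> measurable C ->
  (forall x y, K x -> L y -> C ((1 - t) *: x + t *: y)) ->
  0 < a -> 0 < b -> b <= a ->
  ((a `^ bm_dim)%:E <= \int[lebesgue_rV n]_x damped 1 K x)%E ->
  ((b `^ bm_dim)%:E <= \int[lebesgue_rV n]_x damped 1 L x)%E ->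
  ((((1 - t) * a + t * b) `^ bm_dim)%:E <=
    \int[lebesgue_rV n]_x damped 1 C x)%E.
Proof.
move=> t01 stK stL mC KLC a0 b0 ba aK bL.
have [t0 t1] := andP t01.
have t1' : 0 < 1 - t by rewrite subr_gt0.
have Z0 := wmean_gt0 t01 a0 b0; set Z := _ + _ in Z0 *.
pose s := t * b / Z; pose l := Z / a; pose mu := Z / b.
have l0 : 0 < l by rewrite divr_gt0.
have mu0 : 0 < mu by rewrite divr_gt0.
have s0 : 0 < s by rewrite divr_gt0// mulr_gt0.
have sE : 1 - s = (1 - t) * a / Z.
  by rewrite /s -{1}(divff (lt0r_neq0 Z0)) -mulrBl {1}/Z addrK.
have s1 : 0 < 1 - s by rewrite sE divr_gt0// mulr_gt0.
have s01 : 0 < s < 1 by rewrite s0 -subr_gt0.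
have sl : (1 - s) * l = 1 - t.
  by rewrite sE /l mulrA divfK ?gt_eqF// mulfK ?gt_eqF.
have smu : s * mu = t by rewrite /s /mu mulrA divfK ?gt_eqF// mulfK ?gt_eqF.
have l1 : l <= 1.
  rewrite /l ler_pdivrMr// mul1r /Z.
  have := ler_wpM2l (ltW t0) ba; lra.
have [k [ent k0]] := star_prekopa_leindler t01 s01 l0 mu0 sl smu l1 stK stL mC KLC
  (powR_gt0 _ a0) (powR_gt0 _ b0) aK bL.
apply: le_trans; rewrite lee_fin.
set N := bm_dim in aK bL *.
have NE : N = n%:R + n%:R * (p - 1)^-1.
  by rewrite /N /bm_dim; field; rewrite gt_eqF.
have aZ : ln a = ln Z - ln l by rewrite /l ln_div ?posrE// opprB addrC subrK.
have bZ : ln b = ln Z - ln mu by rewrite /mu ln_div ?posrE// opprB addrC subrK.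
clearbody N l mu s Z => {sE}.
have lnP x y : 0 < x -> 0 < y -> ln (x ^+ n * y `^ N) = n%:R * ln x + N * ln y.
  move=> x0 y0; rewrite lnM ?posrE ?exprn_gt0 ?powR_gt0//.
  by rewrite lnXn// (ln_powR y) mulr_natl.
have lnQ x y : 0 < x -> 0 < y ->
    ln (x `^ (1 - s) * y `^ s) = (1 - s) * ln x + s * ln y.
  by move=> x0 y0; rewrite lnM ?posrE ?powR_gt0// (ln_powR x) (ln_powR y).
have P0 : 0 < l ^+ n * a `^ N by rewrite mulr_gt0 ?exprn_gt0 ?powR_gt0.
have Q0 : 0 < (mu * k) ^+ n * b `^ N.
  by rewrite mulr_gt0 ?exprn_gt0 ?powR_gt0// mulr_gt0.
rewrite -ler_ln ?posrE ?mulr_gt0 ?powR_gt0// (ln_powR Z).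
rewrite (lnQ _ _ P0 Q0) (lnP _ _ l0 a0) (lnP _ _ (mulr_gt0 mu0 k0) b0) lnM ?posrE// aZ bZ.
have n0 : 0 <= n%:R :> R by [].
have := ler_wpM2l n0 ent; rewrite /rel_entropy -subr_ge0 => h.
rewrite -subr_ge0; apply: le_trans h _.
rewrite le_eqVlt; apply/orP; left; apply/eqP; rewrite NE.
set v := n%:R; set w := (p - 1)^-1; ring.
Qed.

Lemma star_brunn_minkowski (t a b : R) K L C : 0 < t < 1 ->
  star_body K -> star_body L -> measurable C ->
  (forall x y, K x -> L y -> C ((1 - t) *: x + t *: y)) ->
  0 < a -> 0 < b ->
  ((a `^ bm_dim)%:E <= \int[lebesgue_rV n]_x damped 1 K x)%E ->
  ((b `^ bm_dim)%:E <= \int[lebesgue_rV n]_x damped 1 L x)%E ->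
  ((((1 - t) * a + t * b) `^ bm_dim)%:E <=
    \int[lebesgue_rV n]_x damped 1 C x)%E.
Proof.
move=> t01 stK stL mC KLC a0 b0 aK bL.
have [ba|/ltW ab] := leP b a; first exact: (star_brunn_minkowski_le t01 stK stL).
have t01' : 0 < 1 - t < 1 by move: t01; lra.
have LKC x y : L x -> K y -> C ((1 - (1 - t)) *: x + (1 - t) *: y).
  by move=> Lx Ky; rewrite subKr addrC; exact: KLC.
have := star_brunn_minkowski_le t01' stL stK mC LKC b0 a0 ab bL aK.
by rewrite subKr addrC.
Qed.

End star_bodies.

(** * From sets to functions by rearrangement *)

Section power_weight.
Context {R : realType}.
Local Notation mu := (@lebesgue_measure R).
Variable N : R.
Hypothesis N1 : 1 < N.

Let N0 : 0 < N. Proof. exact: lt_trans N1. Qed.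

Lemma derivable_powR_itv (q b : R) : 0 < q -> 0 < b ->
  derivable_oo_LRcontinuous (@powR R ^~ q) 0 b.
Proof.
move=> q0 b0; split.
- by move=> x; rewrite in_itv/= => /andP[x0 _]; have [] := is_derive1_powR q x0.
- by rewrite powR0 ?gt_eqF//; exact: powR_cvg0.
- apply: cvg_at_left_filter.
  have [db _] := is_derive1_powR q b0.
  by move/derivable1_diffP/differentiable_continuous : db; exact.
Qed.

Lemma integral_power_weight (b : R) : 0 < b ->
  (\int[mu]_(x in `[0%R, b]) (N * x `^ (N - 1))%:E = (b `^ N)%:E)%E.
Proof.
move=> b0.
rewrite (@continuous_FTC2 _ (fun x => N * x `^ (N - 1)) (@powR R ^~ N))//.
- by rewrite powR0 ?gt_eqF// sube0.
- have N10 : 0 < N - 1 by rewrite subr_gt0.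
  have cw := derivable_oo_LRcontinuous_within (derivable_powR_itv N10 b0).
  by move=> x; apply: cvgM; [exact: cvg_cst|exact: cw].
- exact: derivable_powR_itv.
- by move=> x; rewrite in_itv/= => /andP[x0 _]; rewrite powR_derive1// in_itv/= x0.
Qed.

(** As a function of A, the density of d(A^N) on the interval where
    A^N <= z, whose total mass is z. *)
Definition power_weight (z : \bar R) (A : R) : R :=
  if (0 < A) && ((A `^ N)%:E <= z)%E then N * A `^ (N - 1) else 0.

Lemma power_weight_ge0 z A : 0 <= power_weight z A.
Proof. by rewrite /power_weight; case: ifP => // _; rewrite mulr_ge0 ?powR_ge0 ?(ltW N0). Qed.

Lemma measurable_power_weight d (T : measurableType d) (m : T -> \bar R) :
  measurable_fun setT m ->
  measurable_fun setT (fun z : measurableTypeR R * T =>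
    (power_weight (m z.2) z.1)%:E).
Proof.
move=> mm; pose S2 := (measurableTypeR R * T)%type.
pose E := [set z : S2 | 0 < z.1 /\ ((z.1 `^ N)%:E <= m z.2)%E].
have mE : measurable E.
  rewrite (_ : E = (fst @^-1` `]0%R, +oo[%classic) `&`
      [set z : S2 | ((z.1 `^ N)%:E <= m z.2)%E]); last first.
    by apply/seteqP; split=> -[x u] /=; rewrite /E/= in_itv/= andbT.
  apply: measurableI.
    by rewrite -[X in measurable X]setTI; exact: measurable_fst.
  rewrite -[X in measurable X]setTI; apply: measurable_lee => //.
    apply/measurable_EFinP; apply: (measurableT_comp (measurable_powR N)).
    exact: measurable_fst.
  by apply: measurableT_comp => //; exact: measurable_snd.
apply/measurable_EFinP.
rewrite (_ : (fun z => _) = (fun z : S2 => \1_E z * (N * z.1 `^ (N - 1)))).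
  apply: measurable_funM; first exact: measurable_indic.
  apply: measurable_funM => //; apply: (measurableT_comp (measurable_powR (N - 1))).
  exact: measurable_fst.
apply/funext => -[A x] /=; rewrite /power_weight indicE.
case: ifPn => [/andP[A0 Am]|h]; first by rewrite mem_set ?mul1r.
by rewrite memNset ?mul0r// => -[A0 Am]; move: h; rewrite A0 Am.
Qed.

Lemma integral_power_weightE (z : \bar R) : (0 <= z)%E ->
  (\int[mu]_A (power_weight z A)%:E = z)%E.
Proof.
have fin (r : R) : 0 <= r -> (\int[mu]_A (power_weight r%:E A)%:E = r%:E)%E.
  rewrite le_eqVlt => /predU1P[<-|r0].
    apply: integral0_eq => A _; rewrite /power_weight lee_fin.
    by case: (ltP 0 A) => //= A0; rewrite leNgt powR_gt0.
  pose b := r `^ N^-1.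
  have b0 : 0 < b by exact: powR_gt0.
  have bN : b `^ N = r by rewrite -powRrM mulVf ?gt_eqF// powRr1// ltW.
  rewrite -{2}bN -integral_power_weight//.
  rewrite -integral_itv_obnd_cbnd; last first.
    apply: measurable_funTS; apply/measurable_EFinP; apply: measurable_funM => //.
  rewrite [RHS]integral_mkcond; apply: eq_integral => A _.
  rewrite patchE mem_setE in_itv/= /power_weight lee_fin -bN.
  have [A0|//] := ltP 0 A.
  have -> : (A `^ N <= b `^ N) = (A <= b).
    apply/idP/idP => [|Ab]; last first.
      by apply: ge0_ler_powR; rewrite ?nnegrE ?(ltW N0) ?(ltW A0) ?(ltW b0).
    by apply: contraTT; rewrite -!ltNge => Ab; apply: gt0_ltr_powR; rewrite ?nnegrE ?(ltW A0) ?(ltW b0).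
  by case: ifP.
case: z => [r r0| _|//]; first exact: fin.
apply/eqyP => r r0; rewrite -(fin _ (ltW r0)).
have mw (x : \bar R) : measurable_fun setT (fun A => (power_weight x A)%:E).
  have h := @measurable_power_weight _ (measurableTypeR R) (cst x) (measurable_cst x).
  exact: (measurableT_comp h (pair2_measurable (0 : measurableTypeR R))).
have w0 (A : R) : [set: R] A -> (0 <= (power_weight r%:E A)%:E)%E.
  by move=> _; rewrite lee_fin power_weight_ge0.
apply: (@ge0_le_integral _ (measurableTypeR R) R mu _ measurableT _ _ w0 (mw _) (mw _)).
move=> A _; rewrite lee_fin /power_weight leey andbT.
case: ifPn => [/andP[-> _]//|_]; case: ifP => // _.
by rewrite mulr_ge0 ?powR_ge0// ltW.
Qed.

Section rearrangement.
Context d (T : measurableType d) (m : {sigma_finite_measure set T -> \bar R}).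
Implicit Types F : T -> \bar R.

(** The decreasing rearrangement of F on the half-line equipped with the
    measure d(A^N), times the density N A^(N - 1) of that measure: at A > 0 its
    first factor is the length of the interval of the levels u whose
    superlevel set has measure at least A^N. *)
Definition rearrangement F (A : R) : \bar R :=
  (\int[mu]_u (power_weight (m (superlevel F u)) A)%:E)%E.

Let measurable_weight2 F : measurable_fun setT F ->
  measurable_fun setT (fun z : measurableTypeR R * measurableTypeR R =>
    (power_weight (m (superlevel F z.2)) z.1)%:E).
Proof.
move=> mF; exact: (measurable_power_weight (measurable_measure_superlevel m mF)).
Qed.

Lemma rearrangement_ge0 F A : (0 <= rearrangement F A)%E.
Proof. by apply: integral_ge0 => u _; rewrite lee_fin power_weight_ge0. Qed.

Lemma measurable_rearrangement F : measurable_fun setT F ->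
  measurable_fun setT (rearrangement F : measurableTypeR R -> \bar R).
Proof.
move=> /measurable_weight2 mF.
apply: (@measurable_fun_fubini_tonelli_F _ _ _ _ R mu _ mF).
by move=> x; rewrite lee_fin power_weight_ge0.
Qed.

Lemma integral_rearrangement F : measurable_fun setT F ->
  (forall x, 0 <= F x)%E ->
  (\int[mu]_A rearrangement F A = \int[m]_x F x)%E.
Proof.
move=> mF F0; rewrite layer_cake//.
have w0 z : (0 <= (power_weight (m (superlevel F z.2)) z.1)%:E)%E.
  by rewrite lee_fin power_weight_ge0.
have := @fubini_tonelli _ _ _ _ R mu mu _ (measurable_weight2 mF) w0.
move=> ->; apply: eq_integral => u _.
by rewrite /= integral_power_weightE ?measure_ge0.
Qed.

(** The levels u whose superlevel set has measure at least A^N form an interval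
    starting at 0; if it stopped at u, the rearrangement would be at most
    N A^(N - 1) u. *)
Lemma rearrangement_superlevel F A w : measurable_fun setT F -> 0 < w ->
  (w%:E <= rearrangement F A)%E ->
  0 < A /\ forall u, 0 < u -> u < w / (N * A `^ (N - 1)) ->
    ((A `^ N)%:E <= m (superlevel F u))%E.
Proof.
move=> mF w0 wA; have [A0|A0] := ltP 0 A; last first.
  move: wA; rewrite /rearrangement integral0_eq ?lee_fin ?leNgt ?w0// => u _.
  by rewrite /power_weight ltNge A0.
have c0 : 0 < N * A `^ (N - 1) by rewrite mulr_gt0 ?powR_gt0.
split=> // u u0 uw; rewrite leNgt; apply/negP => Au.
move: wA; apply/negP; rewrite -ltNge.
apply: (@le_lt_trans _ _ ((N * A `^ (N - 1)) * u)%:E); last first.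
  by rewrite lte_fin mulrC -ltr_pdivlMr.
have iE : (\int[mu]_(x in `]0%R, u[) (N * A `^ (N - 1))%:E =
    ((N * A `^ (N - 1)) * u)%:E)%E.
  rewrite integral_cst//= lebesgue_measure_itv/= lte_fin u0.
  by rewrite -EFinD subr0 -EFinM.
rewrite -iE [leRHS]integral_mkcond; apply: ge0_le_integral => //.
- by move=> v _; rewrite lee_fin power_weight_ge0.
- exact: (measurableT_comp (measurable_weight2 mF) (pair1_measurable (A : measurableTypeR R))).
- by apply/(measurable_restrictT _ _).1.
move=> v _; rewrite patchE mem_setE in_itv/= /power_weight A0/=.
case: ifPn => Av; last by case: ifP => // _; rewrite lee_fin ltW.
have [v0|v0] := ltP 0 v; last first.
  move: Av; rewrite (_ : superlevel F v = set0) ?measure0.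
    by rewrite lee_fin leNgt powR_gt0.
  by apply/seteqP; split=> x // [+ _]; rewrite ltNge v0.
have [//|uv] := ltP v u.
have : (m (superlevel F v) <= m (superlevel F u))%E.
  apply: le_measure; rewrite ?inE; try exact: measurable_superlevel.
  exact: superlevel_mono.
by move=> /(le_trans Av); rewrite leNgt Au.
Qed.

Lemma rearrangement_ge F A w : measurable_fun setT F -> 0 < A -> 0 < w ->
  (forall u, 0 < u < w -> ((A `^ N)%:E <= m (superlevel F u))%E) ->
  ((N * A `^ (N - 1) * w)%:E <= rearrangement F A)%E.
Proof.
move=> mF A0 w0 h.
have iE : (\int[mu]_(x in `]0%R, w[) (N * A `^ (N - 1))%:E =
    ((N * A `^ (N - 1)) * w)%:E)%E.
  rewrite integral_cst//= lebesgue_measure_itv/= lte_fin w0.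
  by rewrite -EFinD subr0 -EFinM.
rewrite -iE [leLHS]integral_mkcond; apply: ge0_le_integral => //.
- move=> v _; rewrite patchE; case: ifP => // _.
  by rewrite lee_fin mulr_ge0 ?powR_ge0 ?(ltW N0).
- by apply/(measurable_restrictT _ _).1.
- exact: (measurableT_comp (measurable_weight2 mF) (pair1_measurable (A : measurableTypeR R))).
move=> v _; rewrite patchE mem_setE in_itv/=.
case: ifPn => [vw|_]; last by rewrite lee_fin power_weight_ge0.
by rewrite /power_weight A0 h.
Qed.

End rearrangement.

(** The superlevel sets satisfy a Brunn-Minkowski inequality of dimension N, so
    their measures are treated as A^N and the rearrangements F~, G~, H~ satisfy
    a one-dimensional hypothesis with the order ga given by
    1 / ga = 1 / al + (N - 1); the term N - 1 is the effect of the density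
    A^(N - 1), through power_mean_hoelder. The condition al >= -1/N is
    equivalent to ga >= -1, and the order 1 / (1 / ga + 1) produced by
    borell_brascamp_lieb_line is 1 / (1 / al + N). *)
Lemma borell_brascamp_lieb_superlevel d (T : measurableType d)
    (m : {sigma_finite_measure set T -> \bar R}) (t al : R)
    (F G H : T -> \bar R) :
  0 < t < 1 -> - N^-1 <= al ->
  measurable_fun setT F -> measurable_fun setT G -> measurable_fun setT H ->
  (forall x, 0 <= F x)%E -> (forall x, 0 <= G x)%E -> (forall x, 0 <= H x)%E ->
  (forall u v A B, 0 < u -> 0 < v -> 0 < A -> 0 < B ->
    ((A `^ N)%:E <= m (superlevel F u))%E ->
    ((B `^ N)%:E <= m (superlevel G v))%E ->
    ((((1 - t) * A + t * B) `^ N)%:E <=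
      m (superlevel H (power_mean t al%:E u v)))%E) ->
  forall a b, 0 < a -> 0 < b ->
    (a%:E <= \int[m]_x F x)%E -> (b%:E <= \int[m]_x G x)%E ->
    ((power_mean t (if al == - N^-1 then -oo%E else (al / (1 + N * al))%:E) a b)%:E
      <= \int[m]_x H x)%E.
Proof.
move=> t01 alN mF mG mH F0 G0 H0 dom a b a0 b0 aF bG.
pose be := N - 1.
have be0 : 0 < be by rewrite subr_gt0.
have albe : - be^-1 < al.
  by apply: lt_le_trans alN; rewrite ltrN2 ltf_pV2 ?posrE// gtrBl.
have den0 : 0 < 1 + be * al.
  have := albe; rewrite -ltrBlDl sub0r -mulrN1 mulrC => h.
  rewrite -(ltr_pM2l be0) mulN1r mulrN divff ?gt_eqF// in h; lra.
have Nal : -1 <= N * al.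
  by have := ler_wpM2l (ltW N0) alN; rewrite mulrN divff ?gt_eqF.
pose ga := al / (1 + be * al).
have ga1 : -1 <= ga.
  by rewrite /ga ler_pdivlMr// mulN1r /be; lra.
have gaE : (ga == -1) = (al == - N^-1).
  rewrite /ga; apply/eqP/eqP => [h|->].
    have {}h : al = - (1 + be * al) by rewrite -mulN1r -h divfK ?gt_eqF.
    have {}h : N * al = -1 by rewrite /be in h; lra.
    by rewrite -mulN1r -h mulrAC divff ?mul1r ?gt_eqF.
  rewrite (_ : 1 + be * - N^-1 = N^-1).
    by rewrite mulNr divff ?invr_eq0 ?gt_eqF.
  by rewrite /be; field; rewrite gt_eqF.
rewrite -gaE; have -> : al / (1 + N * al) = ga / (1 + ga).
  have -> : 1 + ga = (1 + N * al) / (1 + be * al).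
    rewrite -{1}(divff (lt0r_neq0 den0)) -mulrDl /be; congr (_ / _); ring.
  by rewrite /ga invf_div mulrA divfK ?gt_eqF.
rewrite -(integral_rearrangement m mH H0).
have mr K : measurable_fun setT K ->
    measurable_fun setT (rearrangement m K : measurableTypeR R -> \bar R).
  exact: measurable_rearrangement.
rewrite -(integral_rearrangement m mF F0) in aF.
rewrite -(integral_rearrangement m mG G0) in bG.
apply: (@borell_brascamp_lieb_line R t ga (rearrangement m F) (rearrangement m G)
  (rearrangement m H) t01 ga1 (mr _ mF) (mr _ mG) (mr _ mH)
  (rearrangement_ge0 m F) (rearrangement_ge0 m G) (rearrangement_ge0 m H)
  _ a b a0 b0 aF bG).
move=> x y u v u0 v0 /(rearrangement_superlevel mF u0)[x0 Fx] /(rearrangement_superlevel mG v0)[y0 Gy].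
have Z0 := wmean_gt0 t01 x0 y0; set Z := _ + _ in Z0 *.
have ZE : (1 - t) * x + t * y = Z by [].
pose u' := u / (N * x `^ be); pose v' := v / (N * y `^ be).
have xN0 : 0 < N * x `^ be by rewrite mulr_gt0 ?powR_gt0.
have yN0 : 0 < N * y `^ be by rewrite mulr_gt0 ?powR_gt0.
have u'0 : 0 < u' by rewrite divr_gt0.
have v'0 : 0 < v' by rewrite divr_gt0.
have uE : u = N * (u' * x `^ be) by rewrite mulrCA /u' divfK ?gt_eqF.
have vE : v = N * (v' * y `^ be) by rewrite mulrCA /v' divfK ?gt_eqF.
rewrite -/be -/u' in Fx; rewrite -/be -/v' in Gy.
clearbody u' v' Z.
set w0 := power_mean t al%:E u' v'.
have w00 : 0 < w0 by apply: power_mean_gt0; rewrite ?ltry.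
apply: (@le_trans _ _ (N * Z `^ be * w0)%:E).
  rewrite lee_fin uE vE -mulrA.
  have ux0 : 0 < u' * x `^ be by rewrite mulr_gt0 ?powR_gt0.
  have vy0 : 0 < v' * y `^ be by rewrite mulr_gt0 ?powR_gt0.
  rewrite (power_meanZ _ t01 N0 ux0 vy0) ler_pM2l//.
  have := @power_mean_hoelder R t al be u' x v' y t01 be0 (ltW albe) u'0 x0 v'0 y0.
  by rewrite (gt_eqF albe) -/ga -/w0 ZE [Z `^ be * w0]mulrC.
(* A level w below the mean w0 is itself a mean, that of th u' and th v', which
   lie strictly below u' and v'. *)
apply: rearrangement_ge => // w /andP[w1 ww].
pose th := w / w0.
have th0 : 0 < th by rewrite divr_gt0.
have th1 : th < 1 by rewrite ltr_pdivrMr// mul1r.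
have thw : th * w0 = w by rewrite divfK ?gt_eqF.
clearbody th; have thu := mulr_gt0 th0 u'0; have thv := mulr_gt0 th0 v'0.
have uF : th * u' < u' by rewrite gtr_pMl.
have vG : th * v' < v' by rewrite gtr_pMl.
have := dom _ _ x y thu thv x0 y0 (Fx _ thu uF) (Gy _ thv vG).
by rewrite power_meanZ// -/w0 thw ZE.
Qed.

End power_weight.

(** * Extended means, and the theorem *)

Section assembly.
Context {R : realType}.

Lemma epower_mean_le (t : R) (r a b c : \bar R) : (0 <= a)%E -> (0 <= b)%E ->
  (0 <= c)%E ->
  (forall u v, 0 < u -> 0 < v -> (u%:E <= a)%E -> (v%:E <= b)%E ->
    ((power_mean t r u v)%:E <= c)%E) ->
  (epower_mean t r a b <= c)%E.
Proof.
move=> a0 b0 c0 h.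
have h' x y : 0 <= x -> (x%:E <= a)%E -> 0 <= y -> (y%:E <= b)%E ->
    ((power_mean t r x y)%:E <= c)%E.
  rewrite le_eqVlt => /predU1P[<- _ _ _|x0 xa].
    by rewrite /power_mean mul0r eqxx.
  rewrite le_eqVlt => /predU1P[<- _|y0 yb].
    by rewrite /power_mean mulr0 eqxx.
  exact: h.
have hs : (ereal_sup [set (power_mean t r xy.1 xy.2)%:E | xy in
    [set xy : R * R | (0 <= xy.1)%R && (xy.1%:E <= a)%E &&
                      (0 <= xy.2)%R && (xy.2%:E <= b)%E]] <= c)%E.
  apply: ge_ereal_sup => _ [[x y] /= /andP[/andP[/andP[x0 xa] y0] yb] <-].
  exact: h'.
case: a b a0 b0 {h} h' hs => [x| |] [y| |] a0 b0 h' hs //=.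
by apply: h'; rewrite // -lee_fin.
Qed.

Section sigma_finite_of.
Context d (T : measurableType d) (m : {measure set T -> \bar R}).

(** A copy of m that carries its sigma-finiteness, for Tonelli's theorem. *)
Definition sigma_finite_of & sigma_finite setT m : set T -> \bar R := m.


HB.instance Definition _ (sf : sigma_finite setT m) :=
  isMeasure.Build d T R (sigma_finite_of sf) (measure0 m) (measure_ge0 m)
    (@measure_semi_sigma_additive _ _ _ m).

HB.instance Definition _ (sf : sigma_finite setT m) :=
  Measure_isSigmaFinite.Build d T R (sigma_finite_of sf) sf.

End sigma_finite_of.

End assembly.

Theorem theorem3p2 (R : realType) (n : nat) (p : R) (V : 'rV[R]_n -> R)
  (nu : {measure set 'rV[R]_n -> \bar R}) (t alpha : R)
  (h f g : 'rV[R]_n -> R) :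
  (1 <= n)%N ->
  1 < p ->
  (forall x, 0 <= V x) ->
  p_homogeneous p V ->
  convex_function [set: convex_lmodType 'rV[R]_n] V ->
  (forall A, measurable A ->
    nu A = (\int[lebesgue_rV n]_(x in A) (expR (- V x))%:E)%E) ->
  0 < t < 1 ->
  - ((p - 1) / (p * n%:R)) <= alpha ->
  (forall x, 0 <= h x) -> (forall x, 0 <= f x) -> (forall x, 0 <= g x) ->
  measurable_fun setT h -> measurable_fun setT f -> measurable_fun setT g ->
  star_unimodal f -> star_unimodal g ->
  (forall x y, power_mean t alpha%:E (f x) (g y) <=
    h ((1 - t) *: x + t *: y)) ->
  let r : \bar R :=
    if alpha == - ((p - 1) / (p * n%:R)) then -oo%E
    else (alpha * (p - 1) / (alpha * p * n%:R + p - 1))%:E in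
  (epower_mean t r (\int[nu]_x (f x)%:E) (\int[nu]_x (g x)%:E)
    <= \int[nu]_x (h x)%:E)%E.
Proof.
move=> n1 p1 V0 Vp Vc nuE t01 al1 h0 f0 g0 mh mf mg sf sg dom.
cbv zeta; set r := if _ then _ else _.
have p0 : 0 < p := lt_trans ltr01 p1.
have q0 : 0 < p - 1 by rewrite subr_gt0.
have mV := measurable_potential p1 V0 Vp Vc.
have dampedE A : measurable A ->
    nu A = (\int[lebesgue_rV n]_x damped V 1 A x)%E.
  move=> mA; rewrite nuE// integral_mkcond; apply: eq_integral => x _.
  rewrite patchE /damped mul1r indicE.
  by case: ifP => _; rewrite ?mul1r ?mul0r.
(* As exp (- V) <= 1, nu is dominated by Lebesgue measure. *)
have sfin : sigma_finite setT nu.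
  have := @sigma_finiteT _ _ R (lebesgue_rV n).
  move=> [D UD Df].
  exists D => // k; have [mD Dk] := Df k; split => //.
  rewrite nuE//; apply: le_lt_trans Dk.
  have mexp : measurable_fun (D k) (fun x => (expR (- V x))%:E).
    apply: measurable_funTS; apply/measurable_EFinP.
    apply: measurableT_comp; first exact: measurable_expR.
    by apply: measurableT_comp => //; exact: oppr_measurable.
  have e0 x : D k x -> (0 <= (expR (- V x))%:E)%E by rewrite lee_fin expR_ge0.
  rewrite -[leRHS]mul1e -integral_cst//.
  apply: (@ge0_le_integral _ _ R _ _ mD _ _ e0 mexp (measurable_cst 1%E)).
  by move=> x _; rewrite lee_fin expR_le1 oppr_le0.
pose m : {sigma_finite_measure set 'rV[R]_n -> \bar R} := sigma_finite_of sfin.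
pose N := bm_dim (n := n) p.
have N1 : 1 < N.
  rewrite /N /bm_dim ltr_pdivlMr// mul1r ltrBlDr.
  have : 1 <= n%:R :> R by rewrite ler1n.
  by move=> /(ler_wpM2l (ltW p0)); lra.
have NV : N^-1 = (p - 1) / (p * n%:R) by rewrite /N /bm_dim invf_div.
have rE : r = if alpha == - N^-1 then -oo%E else (alpha / (1 + N * alpha))%:E.
  rewrite /r NV; case: ifP => // _; congr (_%:E).
  have -> : 1 + N * alpha = (alpha * p * n%:R + p - 1) / (p - 1).
    by rewrite /N /bm_dim; field; rewrite gt_eqF.
  by rewrite invf_div mulrA.
have E0 (k : 'rV[R]_n -> R) : (forall x, 0 <= k x) -> forall x, (0 <= (k x)%:E)%E.
  by move=> k0 x; rewrite lee_fin.
have mE (k : 'rV[R]_n -> R) : measurable_fun setT k ->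
    measurable_fun setT (EFin \o k) by move=> /measurable_EFinP.
have I0 (k : 'rV[R]_n -> R) : (forall x, 0 <= k x) -> (0 <= \int[nu]_x (k x)%:E)%E.
  by move=> k0; apply: integral_ge0 => x _; rewrite lee_fin.
apply: epower_mean_le; [exact: I0|exact: I0|exact: I0|].
rewrite rE; apply: (@borell_brascamp_lieb_superlevel R N N1 _ _ m t alpha (EFin \o f) (EFin \o g)
  (EFin \o h) t01 _ (mE _ mf) (mE _ mg) (mE _ mh) (E0 _ f0) (E0 _ g0) (E0 _ h0)).
  by rewrite NV.
move=> u v A B u0 v0 A0 B0.
have star (k : 'rV[R]_n -> R) (w : R) : star_unimodal k -> 0 < w -> star_body (superlevel (EFin \o k) w).
  move=> /(_ w) + w0; congr star_body.
  by apply/seteqP; split=> x; rewrite /superlevel/= lee_fin // => -[].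
have stF := star f u sf u0; have stG := star g v sg v0.
have mC := measurable_superlevel (power_mean t alpha%:E u v) (mE _ mh).
have -> S : m S = nu S by [].
rewrite (dampedE _ stF.1) (dampedE _ stG.1) (dampedE _ mC).
apply: (star_brunn_minkowski p1 V0 Vp Vc t01 stF stG mC _ A0 B0).
move=> x y [_ ux] [_ vy]; split; first by apply: power_mean_gt0; rewrite ?ltry.
apply: (@le_trans _ _ (power_mean t alpha%:E (f x) (g y))%:E).
  by rewrite lee_fin power_mean_le// -lee_fin.
by rewrite lee_fin.
Qed.
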